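(* Let $\lambda=\langle 1^{m_1},2^{m_2},\dots,k^{m_k}\rangle$ be a partition of $k\ge 4$, and let $c_\lambda$ be the coefficient of $e_\lambda z^{|\lambda|}$ in $\frac12\mathcal{X}_{C_v}(z)=\frac12\sum_{n\ge 3}X_{C_{n,v}}z^{n+1}$. Then: (a) $c_{(k)}=k(2k-5)$. (b) If $m_1>1$, then $c_\lambda=0$. (c) If $m_1=1$ and $\lambda=\mu\cup 1$ (so that $m_1(\mu)=0$), then $$c_\lambda=\sum_{\substack{i\ge 4\\ i\in\mathrm{supp}(\mu)}}(i-1)(i-3)\,\varepsilon(\mu-i)$$ (which is $0$ unless $\lambda$ has a part of size at least $4$). (d) If $m_1=m_2=0$, then $$c_\lambda=\sum_{a\in\mathrm{supp}(\lambda)}(2a^2-5a)\,\varepsilon(\lambda-a).$$ (e) If $m_1=0$ and $m_2=\ell(\lambda)$, then $c_\lambda=0$. (f) If $m_1=0$ and $1\le m_2<\ell(\lambda)$, then $$c_\lambda=\sum_{\substack{a,b\ge 3\\ (a,b)\in\mathrm{supp}(\lambda)}}\varepsilon(\lambda-a-b)(2a^2-5a)(b-1)+\sum_{\substack{c\ge 3\\ c\in\mathrm{supp}(\lambda)}}\varepsilon(\lambda-c-2)(2c^2-6c+2),$$ where the first sum is over ordered pairs $(a,b)$, and $(a,b)\in\mathrm{supp}(\lambda)$ means that both $a$ and $b$ are in $\mathrm{supp}(\lambda)$ if $a\ne b$, and that $m_a\ge 2$ if $a=b$.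
   Context: The chromatic symmetric function of a finite simple graph $H=(V,E)$ is $X_H=\sum_\kappa\prod_{u\in V}x_{\kappa(u)}$, the sum over all proper colorings $\kappa:V\to\mathbb{Z}_{>0}$. $C_n$ is the cycle on $n$ vertices. The twin of a graph at a vertex $v$ is obtained by adding a new vertex $v'$ joined to $v$ and to all neighbors of $v$; $C_{n,v}$ denotes $C_n$ twinned at a vertex $v$. $e_\lambda$ are the elementary symmetric functions. For a partition $\lambda$: $\ell(\lambda)$ is its number of parts, $m_j=m_j(\lambda)$ the multiplicity of $j$, $\mathrm{supp}(\lambda)=\{j:m_j(\lambda)\ge 1\}$, $\mu\cup 1$ is $\mu$ with an extra part $1$. Define $$\varepsilon(\lambda)=\ell(\lambda)!\prod_{j\in\mathrm{supp}(\lambda)}\frac{(j-1)^{m_j(\lambda)}}{m_j(\lambda)!},\qquad\varepsilon(\emptyset)=1.$$ For a part $a$ of $\lambda$, $\lambda-a$ is $\lambda$ with one part equal to $a$ removed ($\lambda-a-b$ means $(\lambda-a)-b$); if $a$ is not a part of $\lambda$, $\varepsilon(\lambda-a)=0$ by convention. *)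

(* Defs.v *)
From HB Require Import structures.
From mathcomp Require Import all_boot all_order all_algebra.
From mathcomp Require Import finmap multiset.

Set Implicit Arguments.
Unset Strict Implicit.
Unset Printing Implicit Defensive.

Import Order.TTheory GRing.Theory Num.Theory.

Local Open Scope fset_scope.
Local Open Scope mset_scope.
Local Open Scope ring_scope.

(** ** Formal power series in countably many variables

    The variables x_1, x_2, ... are indexed by [nat] (x_(i+1) has index i).  A
    monomial is the multiset of the indices of its variables, so the product of
    monomials is the sum [`+`] of multisets, and a series is given by its
    coefficients. *)

Notation monom := {mset nat} (only parsing).
Definition fps := monom -> rat.

Definition divisors_monom (m : monom) : {fset monom} :=
  [fset seq_mset (mask (tval b) m) | b in {: (size m).-tuple bool}].

Lemma in_divisors_monom (m a : monom) : (a \in divisors_monom m) = (a `<=` m).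
Proof.
apply/imfsetP/idP => /= [[b _ ->]|/msubsetP le_am].
  apply/msubsetP => x; rewrite mset_seqE -count_mem_mset.
  exact/leq_count_subseq/mask_subseq.
have /count_subseqP[s sub_s eq_sa] : forall x, (count_mem x a <= count_mem x m)%N.
  by move=> x; rewrite !count_mem_mset.
case/subseqP: sub_s => b size_b def_s.
exists (Tuple (introT eqP size_b)) => //=.
rewrite -def_s -[LHS]seq_mset_id; exact/eq_seq_msetP.
Qed.

Definition fps_zero : fps := fun=> 0.
Definition fps_one : fps := fun m => (m == mset0)%:R.
Definition fps_scale (a : rat) (f : fps) : fps := fun m => a * f m.
Definition fps_mul (f g : fps) : fps :=
  fun m => \sum_(a <- divisors_monom m) f a * g (m `\` a).

(** ** Partitions, as multisets of positive parts

    [la j] is the multiplicity m_j of the part j, [finsupp la] is supp(la), and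
    [size la] is the number of parts. *)

Definition is_partition (la : {mset nat}) : bool := 0%N \notin la.

Definition weight (la : {mset nat}) : nat := (\sum_(j <- la) j)%N.

(* A partition of n has at most n parts, all at most n: pad it with zeros to get
   an n-tuple. *)
Definition partitions (n : nat) : {fset {mset nat}} :=
  [fset seq_mset [seq val j | j <- tval t & val j != 0%N]
     | t in {: n.-tuple 'I_n.+1} & (\sum_(j <- tval t) val j == n)%N].

Lemma in_partitions (n : nat) (la : {mset nat}) :
  (la \in partitions n) = is_partition la && (weight la == n).
Proof.
apply/imfsetP/idP => /= [[t]|/andP[la0 /eqP wla]].
  rewrite inE => /eqP sum_t ->; apply/andP; split.
    rewrite /is_partition in_mset mset_seqE -has_count.
    rewrite has_pred1; apply/mapP => -[j]; rewrite mem_filter => /andP[/= j0 _] j0E.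
    by rewrite -j0E in j0.
  apply/eqP; rewrite /weight (perm_big _ (perm_eq_seq_mset _)) big_map big_filter.
  apply: etrans sum_t; rewrite [RHS](bigID (fun j : 'I_n.+1 => val j == 0%N)) /=.
  by rewrite [X in (X + _)%N]big1 // => j /eqP.
have gt0_la j : j \in (la : seq nat) -> (0 < j)%N.
  by move=> la_j; rewrite lt0n; apply: contraNneq la0 => <-.
have le_size : (size la <= n)%N.
  rewrite -sum1_size -wla /weight big_seq [X in (_ <= X)%N]big_seq.
  by apply: leq_sum => j /gt0_la.
have le_part j : j \in (la : seq nat) -> (j < n.+1)%N.
  by move=> la_j; rewrite ltnS -wla /weight (big_rem j) //= leq_addr.
pose t := [seq inord j : 'I_n.+1 | j <- la] ++ nseq (n - size la) ord0.
have size_t : size t == n by rewrite size_cat size_map size_nseq subnKC.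
have val_t : [seq val j | j <- t] = (la : seq nat) ++ nseq (n - size la) 0%N.
  rewrite map_cat map_nseq -map_comp; congr (_ ++ _).
  by rewrite -[RHS]map_id; apply/eq_in_map => j /le_part /= /inordK.
exists (Tuple size_t) => /=.
  by rewrite inE /= -(big_map val predT id) val_t big_cat big_nseq /= iter_addn_0
             mul0n addn0 -wla.
rewrite -(filter_map val (fun j => j != 0%N)) val_t filter_cat filter_nseq /= cats0.
rewrite (all_filterP _) ?seq_mset_id //.
by apply/allP => j /gt0_la; rewrite lt0n.
Qed.

(** ** Elementary symmetric functions *)

Definition esym (j : nat) : fps :=
  fun m => (uniq (m : seq nat) && (size m == j))%:R.

Definition esym_part (la : {mset nat}) : fps :=
  \big[fps_mul/fps_one]_(j <- la) esym j.

(* A power series in z over fps, given by its coefficients F n of z^n, equals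
   \sum_la (c la) e_la z^|la|, the sum being over all partitions la. *)
Definition e_expansion (F : nat -> fps) (c : {mset nat} -> rat) : Prop :=
  forall (n : nat) (m : monom),
    F n m = \sum_(la <- partitions n) c la * esym_part la m.

(** ** Graphs and chromatic symmetric functions *)

Record sgraph := SGraph {
  vertex :> finType;
  adj : rel vertex;
  adj_sym : symmetric adj;
  adj_irrefl : irreflexive adj }.

Definition proper_coloring (H : sgraph) (C : eqType) (kappa : H -> C) : bool :=
  [forall u, forall w, adj u w ==> (kappa u != kappa w)].

(* The coefficient of the monomial m in the sum of \prod_u x_(kappa u) over all
   proper colorings kappa : the number of proper colorings with monomial m.
   Such colorings only use the variables of m. *)
Definition chromatic_sym (H : sgraph) : fps := fun m =>
  #|[set kappa : {ffun H -> finsupp m} |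
      proper_coloring kappa && (seq_mset [seq val (kappa u) | u : H] == m)]|%:R.

Section Cycle.
Variable n : nat.

Definition cycle_adj : rel 'I_n.+3 := [rel i j | (j == ordS i) || (i == ordS j)].

Lemma cycle_adj_sym : symmetric cycle_adj.
Proof. by move=> i j; rewrite /cycle_adj /= orbC. Qed.

Lemma cycle_adj_irrefl : irreflexive cycle_adj.
Proof.
move=> i; rewrite /cycle_adj /= orbb; apply/negbTE/eqP => /(congr1 val) /= eq_i.
have := ltn_ord i; rewrite ltnS leq_eqVlt => /orP[/eqP i_max|lt_i].
  by move: eq_i; rewrite i_max modnn.
by move: eq_i; rewrite modn_small ?ltnS // => /eqP; rewrite ltn_eqF.
Qed.

(* The cycle C_(n+3). *)
Definition cycle_graph : sgraph := SGraph cycle_adj_sym cycle_adj_irrefl.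

End Cycle.

Section Twin.
Variables (H : sgraph) (v : H).

(* [None] is the new vertex v'. *)
Definition twin_adj : rel (option H) := fun x y =>
  match x, y with
  | Some x, Some y => adj x y
  | Some x, None => (x == v) || adj v x
  | None, Some y => (y == v) || adj v y
  | None, None => false
  end.

Lemma twin_adj_sym : symmetric twin_adj.
Proof. by move=> [x|] [y|] //=; rewrite adj_sym. Qed.

Lemma twin_adj_irrefl : irreflexive twin_adj.
Proof. by move=> [x|] //=; rewrite adj_irrefl. Qed.

Definition twin_graph : sgraph := SGraph twin_adj_sym twin_adj_irrefl.

End Twin.

(* \sum_(n >= 3) X_(C_(n,v)) z^(n+1), by its coefficients of z^d; [v n] is the
   vertex at which C_(n+3) is twinned. *)
Definition twinned_cycle_series (v : forall n, cycle_graph n) (d : nat) : fps :=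
  if d is n.+4 then chromatic_sym (twin_graph (v n)) else fps_zero.

(** ** The function epsilon *)

Definition eps (la : {mset nat}) : rat :=
  (size la)`!%:R * \prod_(j <- finsupp la) ((j%:R - 1) ^+ la j / (la j)`!%:R).

Lemma eps0 : eps mset0 = 1.
Proof. by rewrite /eps size_mset0 finsupp0 big_seq_fset0 mulr1. Qed.

(* eps (la - a_1 - ... - a_r) for s = [:: a_1; ...; a_r], which is 0 by
   convention if some a_i is not available for removal. *)
Definition eps_rem (la : {mset nat}) (s : seq nat) : rat :=
  if seq_mset s `<=` la then eps (la `\` seq_mset s) else 0.

(* (a, b) \in supp(la) *)
Definition pair_in_supp (la : {mset nat}) (a b : nat) : bool :=
  if a == b then (2 <= la a)%N else (a \in finsupp la) && (b \in finsupp la).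

(* Main.v *)
(* Counting colorings as words and opening the two triangles that contain the edge vv'
   (with a <> b, [b <> c][a <> c] = [b <> c] + [a <> c] - 1) gives, in degree d >= 4,
     X_(C_(d-1,v)) / 2 = e_2 X_(P_(d-2)) + e_1 X_(C_(d-1)) + 2 X_(C_d) - 3 X_(P_d).
   Let E, E1, E2 be the sums of e_k, k e_k, k(k-1) e_k.  Peeling the first letter of a
   word without equal neighbours, and also the last one for cyclic words, gives
   (E - E1) P = E and (E - E1) C = E2 for the sums P and C of the X_(P_n) and X_(C_n).
   As 1 / (E - E1) is the sum of the eps(la) e_la, this determines the coefficients:
     c(la) = \sum_k (2k^2 - 5k) eps(la - k) + \sum_k k(k-1) eps(la - k - 1)
             + \sum_k eps(la - k - 2) + eps(la - 2),
   and the recursion eps(mu) = \sum_k (k - 1) eps(mu - k) gives the stated forms.  The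
   coefficients are unique since the leading exponent of e_la is the conjugate of la. *)

From HB Require Import structures.
Require Import Defs.
From mathcomp Require Import all_boot all_order all_algebra.
From mathcomp Require Import finmap multiset.
From mathcomp Require Import boolp ring zify.

Set Implicit Arguments.
Unset Strict Implicit.
Unset Printing Implicit Defensive.

Import Order.TTheory GRing.Theory Num.Theory.

Local Open Scope fset_scope.
Local Open Scope mset_scope.
Local Open Scope ring_scope.

(** * Multisets and divisors of a monomial *)

Lemma perm_msetD (K : choiceType) (a b : {mset K}) :
  perm_eq (a `+` b) ((a : seq K) ++ (b : seq K)).
Proof.
by apply/allP=> x _ /=; rewrite count_cat !count_mem_mset msetE2.
Qed.

Lemma size_msetD (K : choiceType) (a b : {mset K}) :
  size (a `+` b) = (size a + size b)%N.
Proof. by rewrite -size_cat (perm_size (perm_msetD a b)). Qed.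

Lemma msubset_size (K : choiceType) (a b : {mset K}) :
  a `<=` b -> (size a <= size b)%N.
Proof. by move=> ab; rewrite -(msetBDKC ab) size_msetD leq_addr. Qed.

Lemma size_msetB (K : choiceType) (a b : {mset K}) :
  b `<=` a -> size (a `\` b) = (size a - size b)%N.
Proof. by move=> ba; rewrite -[in RHS](msetBDKC ba) size_msetD addKn. Qed.

(** Complementation in [m] is an involution on its divisors; commutativity of [fps_mul] rests on
    this. *)
Lemma reindex_divisors (R : nmodType) (m : {mset nat}) (G : {mset nat} -> R) :
  \sum_(a <- divisors_monom m) G a = \sum_(a <- divisors_monom m) G (m `\` a).
Proof.
rewrite -(big_map (fun a => m `\` a) predT G); apply: perm_big.
have inj : {in divisors_monom m &, injective (fun a : {mset nat} => m `\` a)}.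
  move=> a b; rewrite !in_divisors_monom => am bm eab.
  by rewrite -(msetBBK am) eab msetBBK.
apply: uniq_perm; rewrite ?map_inj_in_uniq ?fset_uniq //.
move=> a; apply/idP/mapP => [|[b]]; rewrite !in_divisors_monom.
  move=> am; exists (m `\` a); rewrite ?in_divisors_monom ?msubsetDl //.
  by rewrite msetBBK.
by move=> _ ->; rewrite msubsetDl.
Qed.

(** Both sides run over the ways to split [m] into [b], [d] and a remaining factor; this is what
    associativity of [fps_mul] needs. *)
Lemma big_divisors_exchange (R : nmodType) (m : {mset nat})
    (G : {mset nat} -> {mset nat} -> R) :
  \sum_(a <- divisors_monom m) \sum_(b <- divisors_monom a) G b (a `\` b)
  = \sum_(b <- divisors_monom m) \sum_(d <- divisors_monom (m `\` b)) G b d.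
Proof.
transitivity (\sum_(a <- divisors_monom m)
   \sum_(b <- divisors_monom m | b `<=` a) G b (a `\` b)).
  apply: eq_big_seq => a; rewrite in_divisors_monom => am.
  rewrite -[RHS]big_filter; apply: perm_big; apply: uniq_perm.
  - exact: fset_uniq.
  - by rewrite filter_uniq ?fset_uniq.
  move=> b; rewrite mem_filter !in_divisors_monom.
  by case: (boolP (b `<=` a)) => //= ba; rewrite (msubset_trans ba am).
rewrite (exchange_big_dep predT) //=; apply: eq_big_seq => b.
rewrite in_divisors_monom => bm.
transitivity (\sum_(d <- divisors_monom (m `\` b)) G b ((b `+` d) `\` b)); last first.
  by apply: eq_bigr => d _; rewrite msetDKB.
rewrite -[RHS](big_map (fun d => b `+` d) predT (fun a => G b (a `\` b))).
rewrite -[LHS]big_filter; apply: perm_big; apply: uniq_perm.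
- by rewrite filter_uniq ?fset_uniq.
- rewrite map_inj_in_uniq ?fset_uniq // => x y _ _ exy.
  by rewrite -[x](msetDKB b) exy msetDKB.
move=> a; rewrite mem_filter !in_divisors_monom.
apply/andP/mapP => [[ba am]|[d]].
  by exists (a `\` b); rewrite ?in_divisors_monom ?msetSB ?msetBDKC.
rewrite in_divisors_monom => dm ->; split.
  by apply/msubsetP=> x; rewrite msetE2 leq_addr.
by rewrite -(msetBDKC bm) msetDS.
Qed.

(** * The commutative ring of power series *)

HB.instance Definition _ := gen_eqMixin fps.
HB.instance Definition _ := gen_choiceMixin fps.

Definition fps_add (f g : fps) : fps := fun m => f m + g m.
Definition fps_opp (f : fps) : fps := fun m => - f m.

Lemma fps_addA : associative fps_add.
Proof. by move=> f g h; apply: funext => m; rewrite /fps_add addrA. Qed.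
Lemma fps_addC : commutative fps_add.
Proof. by move=> f g; apply: funext => m; rewrite /fps_add addrC. Qed.
Lemma fps_add0 : left_id fps_zero fps_add.
Proof. by move=> f; apply: funext => m; rewrite /fps_add add0r. Qed.
Lemma fps_addN : left_inverse fps_zero fps_opp fps_add.
Proof. by move=> f; apply: funext => m; rewrite /fps_add addNr. Qed.

HB.instance Definition _ :=
  GRing.isZmodule.Build fps fps_addA fps_addC fps_add0 fps_addN.

Lemma fps_mulA : associative fps_mul.
Proof.
move=> f g h; apply: funext => m; rewrite /fps_mul.
under eq_bigr do rewrite big_distrr /=.
rewrite -(big_divisors_exchange m (fun b d => f b * (g d * h (m `\` b `\` d)))).
apply: eq_big_seq => a; rewrite in_divisors_monom => am.
rewrite big_distrl /=; apply: eq_big_seq => b; rewrite in_divisors_monom => ba.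
by rewrite mulrA -msetBDA msetBDKC.
Qed.

Lemma fps_mulC : commutative fps_mul.
Proof.
move=> f g; apply: funext => m; rewrite /fps_mul reindex_divisors.
apply: eq_big_seq => a; rewrite in_divisors_monom => am.
by rewrite msetBBK // mulrC.
Qed.

Lemma fps_mul_monom (b : {mset nat}) (f : fps) (m : {mset nat}) :
  fps_mul (fun a => (a == b)%:R) f m = if b `<=` m then f (m `\` b) else 0.
Proof.
rewrite /fps_mul; case: ifP => bm.
  rewrite (big_fsetD1 b) ?in_divisors_monom //= eqxx mul1r big1_fset ?addr0 //.
  by move=> a; rewrite !inE => /andP[/negbTE-> _]; rewrite mul0r.
rewrite big_seq big1 // => a; rewrite in_divisors_monom => am.
by case: eqP am => [->|_]; rewrite ?bm ?mul0r.
Qed.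

Lemma fps_mul1 : left_id fps_one fps_mul.
Proof.
by move=> f; apply: funext => m; rewrite fps_mul_monom msub0set msetB0.
Qed.

Lemma fps_mulDl : left_distributive fps_mul fps_add.
Proof.
move=> f g h; apply: funext => m; rewrite /fps_mul /fps_add -big_split /=.
by apply: eq_bigr => a _; rewrite mulrDl.
Qed.

(* The ring operations are locked: otherwise failing unifications between series
   unfold them down to the representation of multisets. *)
HB.lock Definition ring_one : fps := fps_one.
HB.lock Definition ring_mul : fps -> fps -> fps := fps_mul.

Lemma ring_mulE : ring_mul = fps_mul. Proof. exact: ring_mul.unlock. Qed.
Lemma ring_oneE : ring_one = fps_one. Proof. exact: ring_one.unlock. Qed.

Lemma ring_mulA : associative ring_mul.
Proof. rewrite ring_mulE; exact: fps_mulA. Qed.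
Lemma ring_mulC : commutative ring_mul.
Proof. rewrite ring_mulE; exact: fps_mulC. Qed.
Lemma ring_mul1 : left_id ring_one ring_mul.
Proof. rewrite ring_mulE ring_oneE; exact: fps_mul1. Qed.
Lemma ring_mulDl : left_distributive ring_mul fps_add.
Proof. rewrite ring_mulE; exact: fps_mulDl. Qed.

Lemma ring_one_neq0 : ring_one != 0 :> fps.
Proof.
rewrite ring_oneE; apply/eqP => /(congr1 (fun f : fps => f mset0)) /eqP.
by rewrite /fps_one eqxx oner_eq0.
Qed.

HB.instance Definition _ := GRing.Zmodule_isComNzRing.Build fps
  ring_mulA ring_mulC ring_mul1 ring_mulDl ring_one_neq0.

Lemma coef_fpsD (f g : fps) m : (f + g) m = f m + g m. Proof. by []. Qed.
Lemma coef_fpsN (f : fps) m : (- f) m = - f m. Proof. by []. Qed.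
Lemma coef_fps1 m : (1 : fps) m = (m == mset0)%:R.
Proof. by rewrite -[LHS]/(ring_one m) ring_oneE. Qed.
Lemma coef_fpsM (f g : fps) m :
  (f * g) m = \sum_(a <- divisors_monom m) f a * g (m `\` a).
Proof. by rewrite -[LHS]/(ring_mul f g m) ring_mulE. Qed.
Lemma coef_fps_sum (I : Type) (r : seq I) (Q : pred I) (f : I -> fps) m :
  (\sum_(i <- r | Q i) f i) m = \sum_(i <- r | Q i) f i m.
Proof. by elim/big_rec2: _ => // i x y _ <-. Qed.
Lemma coef_fps_muln (f : fps) n m : (f *+ n) m = f m *+ n.
Proof. by elim: n => // n IH; rewrite !mulrS coef_fpsD IH. Qed.

HB.lock Definition fps_var (s : nat) : fps := fun m => (m == [mset s])%:R.

Lemma coef_varM s (f : fps) m :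
  (fps_var s * f) m = if s \in m then f (m `\ s) else 0.
Proof.
by rewrite -[LHS]/(ring_mul _ _ m) ring_mulE fps_var.unlock fps_mul_monom msub1set.
Qed.

(** Induction on the degree: the coefficient of [f * g] at [m] is [g m] plus terms in which [g] is
    evaluated at monomials of smaller degree. *)
Lemma fps_mulfI (f g : fps) : f mset0 = 1 -> f * g = 0 -> g = 0.
Proof.
move=> f0 fg0; apply: funext => m; have [n] := ubnP (size m).
elim: n m => // n IH m; rewrite ltnS => mn.
have := congr1 (fun h : fps => h m) fg0; rewrite coef_fpsM => /=.
rewrite (big_fsetD1 mset0) ?in_divisors_monom ?msub0set //= f0 mul1r msetB0.
rewrite big1_fset ?addr0 // => a; rewrite !inE in_divisors_monom => /andP[a0 am] _.
rewrite IH ?mulr0 // size_msetB // (leq_trans _ mn) //.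
have := size_mset_eq0 a; rewrite (negbTE a0) => a0'.
by have := msubset_size am; lia.
Qed.

Lemma esym_partE (la : {mset nat}) :
  esym_part la = \prod_(j <- (la : seq nat)) (Defs.esym j : fps).
Proof. by rewrite /esym_part -ring_mulE -ring_oneE. Qed.

Lemma esym_partD (a b : {mset nat}) :
  esym_part (a `+` b) = esym_part a * esym_part b.
Proof.
rewrite !esym_partE -big_cat; exact/perm_big/perm_msetD.
Qed.

Lemma esym_part1 k : esym_part [mset k] = Defs.esym k.
Proof. by rewrite esym_partE enum_msetn big_seq1. Qed.

(** * Words without equal neighbours *)

(** The commutative image of the noncommutative series in which each word [w] has coefficient [Q w]:
    the permutations of [m] are the words with monomial [m]. *)
HB.lock Definition word_series (Q : seq nat -> rat) : fps :=
  fun m : {mset nat} => \sum_(w <- permutations m) Q w.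

Lemma coef_word_series Q m :
  word_series Q m = \sum_(w <- permutations m) Q w.
Proof. by rewrite word_series.unlock. Qed.

Lemma perm_eq_mset_cons s (m : {mset nat}) w :
  s \in m -> perm_eq (s :: w) m = perm_eq w (m `\ s).
Proof.
move=> sm; have pm : perm_eq m (s :: (m `\ s : seq nat)).
  apply/allP => x _ /=; rewrite !count_mem_mset msetB1E [s == x]eq_sym.
  by have [->|_] := eqVneq x s; move: sm; rewrite in_mset; lia.
by rewrite (permPr pm) perm_cons.
Qed.

Lemma eq_in_word_series (Q Q' : seq nat -> rat) (m : {mset nat}) :
  (forall w, perm_eq w m -> Q w = Q' w) -> word_series Q m = word_series Q' m.
Proof.
move=> eqQ; rewrite !coef_word_series.
by apply: eq_big_seq => w; rewrite mem_permutations => /eqQ.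
Qed.

Lemma eq_word_series Q Q' : Q =1 Q' -> word_series Q = word_series Q'.
Proof. by move=> eqQ; apply: funext => m; apply: eq_in_word_series. Qed.

Lemma word_seriesD Q Q' :
  word_series (fun w => Q w + Q' w) = word_series Q + word_series Q'.
Proof.
by apply: funext => m; rewrite coef_fpsD !coef_word_series -big_split.
Qed.

Lemma word_seriesN Q : word_series (fun w => - Q w) = - word_series Q.
Proof. by apply: funext => m; rewrite coef_fpsN !coef_word_series -sumrN. Qed.

Lemma word_series_perm (phi : seq nat -> seq nat) Q :
  injective phi -> (forall w, perm_eq (phi w) w) ->
  word_series Q = word_series (Q \o phi).
Proof.
move=> phiI phiP; apply: funext => m; rewrite !coef_word_series.
rewrite -(big_map phi predT Q); apply: perm_big.
have uphi : uniq [seq phi w | w <- permutations m].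
  by rewrite map_inj_uniq ?permutations_uniq.
rewrite perm_sym; apply: uniq_perm; rewrite ?permutations_uniq //.
(* An injective image of a finite list that stays inside the list exhausts it. *)
apply: (uniq_min_size uphi _ _).2; last by rewrite size_map.
move=> w /mapP[u]; rewrite mem_permutations => um ->.
by rewrite mem_permutations (permPl (phiP u)).
Qed.

Definition starts (s : nat) (w : seq nat) : bool := ohead w == Some s.

Lemma starts_cons s a w : starts s (a :: w) = (a == s).
Proof. by []. Qed.

(** Prefixing [s] is a bijection from the words with monomial [m / x_s] onto the words with monomial
    [m] that start with [s]. *)
Lemma word_series_starts s Q : (forall w, ~~ starts s w -> Q w = 0) ->
  word_series Q = fps_var s * word_series (fun w => Q (s :: w)).
Proof.
move=> Q0; apply: funext => m; rewrite coef_varM; case: ifP => sm; last first.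
  rewrite coef_word_series big_seq big1 // => w; rewrite mem_permutations => wm.
  apply: Q0; case: w wm => //= a w /perm_mem/(_ a).
  by rewrite mem_head => am; apply/eqP => -[as_]; rewrite as_ sm in am.
rewrite !coef_word_series -(big_map (cons s) predT Q).
rewrite (bigID (starts s)) /= [X in _ + X]big1 ?addr0; last by move=> w /Q0.
rewrite -big_filter; apply: perm_big; apply: uniq_perm.
- by rewrite filter_uniq ?permutations_uniq.
- by rewrite map_inj_uniq ?permutations_uniq // => x y [].
move=> w; rewrite mem_filter mem_permutations.
apply/andP/mapP => [[]|[u]].
  case: w => // a w /eqP[->]; rewrite perm_eq_mset_cons // => wm.
  by exists w; rewrite ?mem_permutations.
by rewrite mem_permutations => um ->; rewrite perm_eq_mset_cons // /starts /=.
Qed.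

Definition carlitz : pred (seq nat) := sorted (fun x y => x != y).
(** Words with fewer than two letters fail, since their first and last letters agree; on two letters
    the condition is that of a single edge. *)
Definition cyclic_carlitz (w : seq nat) : bool :=
  carlitz w && (ohead w != ohead (rev w)).

Definition path_series : fps := word_series (fun w => (carlitz w)%:R).
Definition cycle_series : fps := word_series (fun w => (cyclic_carlitz w)%:R).
Definition path_from s : fps :=
  word_series (fun w => (carlitz w && starts s w)%:R).
Definition path_between s t : fps :=
  word_series (fun w => [&& carlitz w, starts s w & starts t (rev w)]%:R).

Lemma carlitz_rev w : carlitz (rev w) = carlitz w.
Proof. by rewrite /carlitz rev_sorted; apply: eq_sorted => x y; rewrite eq_sym. Qed.

Lemma carlitz_cons s w : carlitz (s :: w) = carlitz w && ~~ starts s w.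
Proof.
by case: w => //= a w; rewrite andbC /starts /= [s == a]eq_sym.
Qed.

Lemma word_series_rev Q : word_series Q = word_series (fun w => Q (rev w)).
Proof.
apply: (word_series_perm (phi := rev)); first exact: (can_inj revK).
by move=> w; rewrite perm_rev.
Qed.

(** Deleting the first letter [s] leaves an arbitrary Carlitz word that does not start with [s], so
    [path_from s] equals [x_s] times the difference of [path_series] and [path_from s]. *)
Lemma path_from_rec s : (1 + fps_var s) * path_from s = fps_var s * path_series.
Proof.
rewrite mulrDl mul1r {1}/path_from (word_series_starts (s := s)); last first.
  by move=> w /negbTE->; rewrite andbF.
rewrite -mulrDr; congr (_ * _); rewrite /path_series.
apply/esym/eqP; rewrite -subr_eq -word_seriesN -word_seriesD.
  apply/eqP/eq_word_series => w.
rewrite carlitz_cons starts_cons eqxx andbT.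
by case: carlitz; case: starts; rewrite ?subrr ?subr0.
Qed.

Lemma path_from_rev s :
  path_from s = word_series (fun w => (carlitz w && starts s (rev w))%:R).
Proof.
by rewrite /path_from word_series_rev; apply: eq_word_series => w; rewrite carlitz_rev.
Qed.

Lemma path_between_rec s t : s != t ->
  (1 + fps_var s) * path_between s t = fps_var s * path_from t.
Proof.
move=> st; rewrite mulrDl mul1r {1}/path_between (word_series_starts (s := s)).
  rewrite -mulrDr; congr (_ * _); rewrite path_from_rev.
  apply/esym/eqP; rewrite -subr_eq -word_seriesN -word_seriesD.
  apply/eqP/eq_word_series => w.
  rewrite carlitz_cons starts_cons eqxx /=.
  (* Only the empty [w] needs care: the word is then [s] alone, and its last letter differs from
     [t]. *)
  have -> : starts t (rev (s :: w)) = starts t (rev w).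
    rewrite rev_cons /starts; case: (rev w) => //=.
    by apply/negbTE; apply: contraNneq st => -[->].
  by case: carlitz; case: (starts s w); case: starts; rewrite /= ?subrr ?subr0.
by move=> w /negbTE->; rewrite andbF.
Qed.

(** * Squarefree monomials and the clearing of denominators *)

HB.lock Definition sets_series (A B : seq nat) : fps := fun m : {mset nat} =>
  [&& uniq m, all [in m] A & all (fun x => x \notin m) B]%:R.

Lemma coef_sets_series A B m :
  sets_series A B m = [&& uniq m, all [in m] A & all (fun x => x \notin m) B]%:R.
Proof. by rewrite sets_series.unlock. Qed.

Lemma mset_uniqP (m : {mset nat}) : reflect (forall x, (m x <= 1)%N) (uniq m).
Proof.
apply: (iffP idP) => [um x|le1].
  by rewrite -count_mem_mset count_uniq_mem ?leq_b1.
by apply: count_mem_uniq => x; rewrite count_mem_mset; have := le1 x; rewrite in_mset; lia.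
Qed.

Lemma sets_series_split A B s :
  sets_series A (s :: B) + sets_series (s :: A) B = sets_series A B.
Proof.
apply: funext => m; rewrite coef_fpsD !coef_sets_series /=.
by case: uniq; case: (s \in m); case: all; case: all; rewrite /= ?addr0 ?add0r.
Qed.

Lemma sets_series_var A B s : s \notin A -> s \notin B ->
  fps_var s * sets_series A (s :: B) = sets_series (s :: A) B.
Proof.
move=> sA sB; apply: funext => m; rewrite coef_varM !coef_sets_series /=.
case: ifP => sm; last by rewrite andbF.
have eqm x : x != s -> (x \in m `\ s) = (x \in m).
  by move=> xs; rewrite in_msetB1 (negbTE xs).
have -> : all [in m `\ s] A = all [in m] A.
  by apply: eq_in_all => x xA /=; apply: eqm; apply: contraNneq sA => <-.
have -> : all (fun x => x \notin m `\ s) B = all (fun x => x \notin m) B.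
  apply: eq_in_all => x xA /=; congr (~~ _); apply: eqm.
  by apply: contraNneq sB => <-.
have -> : uniq m = uniq (m `\ s) && (s \notin m `\ s).
  apply/mset_uniqP/andP => [le1|[/mset_uniqP le1]]; last first.
    rewrite in_mset => sn x; have := le1 x; move: sn; rewrite !msetB1E eqxx.
    by case: eqP => [->|_]; lia.
  have l x : ((m `\ s) x <= 1)%N by rewrite msetB1E (leq_trans (leq_subr _ _)).
  split; first by apply/mset_uniqP.
  by rewrite in_mset msetB1E eqxx; have := le1 s; lia.
by case: uniq; case: (s \in _); case: all; case: all.
Qed.

(** For disjoint [A] and [B], [sets_series A B] is the product of the [x_a] for [a] in [A] and of
    the factors [1 + x_j] for all [j] outside [A] and [B]. Its factor [1 + x_s] clears the
    denominator of [f = x_s g / (1 + x_s)], and the [x_s] that remains moves [s] into [A]. *)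
Lemma sets_seriesM A B s f g : s \notin A -> s \notin B ->
  (1 + fps_var s) * f = fps_var s * g ->
  sets_series A B * f = sets_series (s :: A) B * g.
Proof.
move=> sA sB fg; rewrite -(sets_series_split A B s) -sets_series_var //.
by transitivity (sets_series A (s :: B) * ((1 + fps_var s) * f)); [|rewrite fg]; ring.
Qed.

(** Sums over all letters are infinite. Identities are therefore checked on the monomials in a
    finite set [K] of variables, where sums over [K] suffice. *)
Definition agree (K : {fset nat}) (f g : fps) : Prop :=
  forall m : {mset nat}, (finsupp m `<=` K)%fset -> f m = g m.

Lemma finsuppS (a m : {mset nat}) : a `<=` m -> (finsupp a `<=` finsupp m)%fset.
Proof.
move=> am; apply/fsubsetP => x; rewrite !msuppE; exact: (msubset_subset am).
Qed.

Lemma agreeM K f f' g g' : agree K f f' -> agree K g g' ->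
  agree K (f * g) (f' * g').
Proof.
move=> ff gg m mK; rewrite !coef_fpsM; apply: eq_big_seq => a.
rewrite in_divisors_monom => am; rewrite ff ?gg //.
  by apply: fsubset_trans mK; apply/finsuppS/msubsetDl.
by apply: fsubset_trans mK; apply: finsuppS.
Qed.

Lemma agree_refl K f : agree K f f. Proof. by []. Qed.

Lemma agree_all f g : (forall K, agree K f g) -> f = g.
Proof. by move=> fg; apply: funext => m; apply: (fg (finsupp m)). Qed.

Lemma big_fset_pick (K : {fset nat}) (f : nat -> rat) s :
  s \in K -> \sum_(t <- K) (s == t)%:R * f t = f s.
Proof.
move=> sK; rewrite (big_fsetD1 s) //= eqxx mul1r big1_fset ?addr0 //.
by move=> t; rewrite !inE eq_sym => /andP[/negbTE-> _] _; rewrite mul0r.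
Qed.

(** Nonempty words are sorted by their first letter; subtracting 1 discards the empty word. *)
Lemma path_series_split K :
  agree K (path_series - 1) (\sum_(s <- K) path_from s).
Proof.
move=> m mK; rewrite coef_fps_sum coef_fpsD coef_fpsN coef_fps1.
rewrite /path_from; under [RHS]eq_bigr do rewrite coef_word_series.
rewrite exchange_big /=.
have -> : (m == mset0)%:R = \sum_(w <- permutations m) (w == [::])%:R :> rat.
  case: eqP => [->|/eqP m0].
    by rewrite enum_mset0 /permutations /= big_seq1.
  rewrite big_seq big1 // => w; rewrite mem_permutations => /perm_size wm.
  by rewrite -size_eq0 wm size_mset_eq0 (negbTE m0).
rewrite /path_series coef_word_series -sumrN -big_split; apply: eq_big_seq => -[|a w].
  by rewrite /= subrr big1.
rewrite mem_permutations => /perm_mem/(_ a); rewrite mem_head => /esym am.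
rewrite /= subr0 -[LHS](@big_fset_pick K (fun=> (carlitz (a :: w))%:R) a).
  by apply: eq_bigr => t _; rewrite -natrM mulnb andbC.
by apply: (fsubsetP mK); rewrite msuppE.
Qed.

(** Words are sorted by their first and last letters, which differ by the cyclic condition. *)
Lemma cycle_series_split K :
  agree K cycle_series (\sum_(s <- K) \sum_(t <- K | s != t) path_between s t).
Proof.
move=> m mK; rewrite coef_fps_sum.
under eq_bigr do rewrite coef_fps_sum.
rewrite /cycle_series coef_word_series /path_between.
under [RHS]eq_bigr do under eq_bigr do rewrite coef_word_series.
under [RHS]eq_bigr do rewrite exchange_big /=.
rewrite exchange_big /=; apply: eq_big_seq => -[|a w].
  by rewrite big1 // => s _; rewrite big1.
rewrite mem_permutations => wm.
have memK x : x \in a :: w -> x \in K.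
  by rewrite (perm_mem wm) => xm; apply: (fsubsetP mK); rewrite msuppE.
rewrite /cyclic_carlitz; case def_r: (rev (a :: w)) => [|b u].
  by move: (congr1 size def_r); rewrite size_rev.
have aK : a \in K by rewrite memK ?mem_head.
have bK : b \in K by rewrite memK // -mem_rev def_r mem_head.
rewrite -[LHS](@big_fset_pick K (fun s => (carlitz (a :: w) && (s != b))%:R) a) //.
apply: eq_bigr => s _.
rewrite -(@big_fset_pick K (fun t => (carlitz (a :: w) && (s != t))%:R) b) //.
rewrite big_distrr [RHS]big_mkcond /=; apply: eq_bigr => t _.
rewrite -!natrM !mulnb !starts_cons.
by case: (path _ _ _); case: (a == s); case: (b == t); case: (s == t). 
Qed.

Lemma sum_pred_finsupp (K : {fset nat}) (m : {mset nat}) (q : pred nat) :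
  (finsupp m `<=` K)%fset ->
  \sum_(t <- K | q t) (t \in m)%:R = (count q (finsupp m))%:R :> rat.
Proof.
move=> mK; transitivity ((\sum_(t <- K | q t && (t \in m)) 1)%N%:R : rat).
  rewrite big_mkcondr natr_sum; apply: eq_bigr => t _.
  by case: (t \in m).
rewrite -big_filter sum1_size -size_filter; congr _%:R; apply: perm_size; apply: uniq_perm.
- by rewrite filter_uniq ?fset_uniq.
- by rewrite filter_uniq ?fset_uniq.
move=> t; rewrite !mem_filter msuppE; case: (q t) => //=.
by case: (boolP (t \in m)) => //= tm; rewrite (fsubsetP mK) ?msuppE.
Qed.

Lemma size_finsupp_uniq (m : {mset nat}) : uniq m -> size (finsupp m) = size m.
Proof. by move=> um; rewrite -(perm_size (perm_undup_mset m)) undup_id. Qed.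

(** The sum of the [a k * e_k]: a squarefree monomial of degree [k] occurs in [e_k] only, with
    coefficient 1. *)
HB.lock Definition esym_series (a : nat -> rat) : fps :=
  fun m : {mset nat} => (uniq m)%:R * a (size m).

Lemma coef_esym_series a m : esym_series a m = (uniq m)%:R * a (size m).
Proof. by rewrite esym_series.unlock. Qed.

(** A squarefree monomial of degree [k] contains [k] variables, hence is counted once for each of
    them. The next sum counts its [k(k-1)] ordered pairs in the same way. *)
Lemma sets_series1_sum K :
  agree K (\sum_(s <- K) sets_series [:: s] [::]) (esym_series (fun k => k%:R)).
Proof.
move=> m mK; rewrite coef_fps_sum coef_esym_series /=.
transitivity (\sum_(s <- K) (uniq m)%:R * (s \in m)%:R : rat).
  by apply: eq_bigr => s _; rewrite coef_sets_series /= !andbT -natrM mulnb.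
rewrite -big_distrr /=; case: (boolP (uniq m)) => um; last by rewrite !mul0r.
by rewrite !mul1r (sum_pred_finsupp predT mK) count_predT size_finsupp_uniq.
Qed.

Lemma sets_series2_sum K :
  agree K (\sum_(s <- K) \sum_(t <- K | s != t) sets_series [:: t; s] [::])
          (esym_series (fun k => k%:R * (k%:R - 1))).
Proof.
move=> m mK; rewrite coef_fps_sum coef_esym_series /=.
under eq_bigr do rewrite coef_fps_sum.
transitivity (\sum_(s <- K) (uniq m)%:R *
   ((s \in m)%:R * \sum_(t <- K | s != t) (t \in m)%:R) : rat).
  apply: eq_bigr => s _; rewrite mulrA big_distrr /=; apply: eq_bigr => t _.
  by rewrite coef_sets_series /= !andbT -!natrM !mulnb andbA andbAC.
rewrite -big_distrr /=; case: (boolP (uniq m)) => um; last by rewrite !mul0r.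
rewrite !mul1r -size_finsupp_uniq //.
under eq_bigr do rewrite (sum_pred_finsupp _ mK).
have := sum_pred_finsupp predT mK; rewrite count_predT => sumE.
rewrite -[X in _ = X * _]sumE big_distrl /=.
apply: eq_bigr => s _; case: (boolP (s \in m)) => sm; rewrite ?mul0r // !mul1r.
have := count_predC (pred1 s) (finsupp m).
rewrite (count_uniq_mem _ (fset_uniq _)) msuppE sm => <-.
rewrite natrD addrC addKr; congr _%:R; apply: eq_count => t /=.
by rewrite eq_sym.
Qed.

(** * The path and cycle series as quotients *)

Local Notation E_ := (esym_series (fun=> 1)).
Local Notation E1_ := (esym_series (fun k => k%:R)).
Local Notation E2_ := (esym_series (fun k => k%:R * (k%:R - 1))).

Lemma sets_series0 : sets_series [::] [::] = E_.
Proof.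
by apply: funext => m; rewrite !coef_sets_series coef_esym_series /= andbT mulr1.
Qed.

Lemma path_series_E : E_ * (path_series - 1) = E1_ * path_series.
Proof.
apply: agree_all => K m mK.
rewrite (agreeM (@agree_refl K _) (@path_series_split K) mK) mulr_sumr.
rewrite -(agreeM (@sets_series1_sum K) (@agree_refl K _) mK) mulr_suml.
congr (_ m); apply: eq_bigr => s _; rewrite -sets_series0.
exact: (sets_seriesM _ _ (path_from_rec s)).
Qed.

(** Clearing denominators twice, first for [s] and then for [t], turns [E_ * path_between s t] into
    [sets_series [:: t; s] [::] * path_series]. *)
Lemma cycle_series_E : E_ * cycle_series = E2_ * path_series.
Proof.
apply: agree_all => K m mK.
rewrite (agreeM (@agree_refl K _) (@cycle_series_split K) mK) mulr_sumr.
rewrite -(agreeM (@sets_series2_sum K) (@agree_refl K _) mK) mulr_suml.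
congr (_ m); apply: eq_bigr => s _; rewrite mulr_suml mulr_sumr.
apply: eq_bigr => t st; rewrite -sets_series0.
rewrite (sets_seriesM _ _ (path_between_rec st)) //.
apply: sets_seriesM => //; last exact: path_from_rec.
by rewrite inE eq_sym.
Qed.

Lemma path_seriesD : (E_ - E1_) * path_series = E_.
Proof.
by rewrite mulrBl -path_series_E mulrBr mulr1 opprB addrCA subrr addr0.
Qed.

Lemma cycle_seriesD : (E_ - E1_) * cycle_series = E2_.
Proof.
apply/eqP; rewrite -subr_eq0; apply/eqP.
(* The identity is checked after multiplication by [E_], which has constant term 1 and can be
   cancelled. *)
apply: (@fps_mulfI E_); first by rewrite coef_esym_series enum_mset0 /= mulr1.
rewrite mulrBr mulrCA cycle_series_E mulrCA path_seriesD; ring.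
Qed.

(** * Chromatic symmetric functions as word series *)

(** Reading the colors along [r] is a bijection from the colorings with monomial [m] onto the
    rearrangements of [m]; the condition on [size m] gives these words one letter per vertex. *)
Lemma chromatic_words (H : sgraph) (r : seq H) (m : {mset nat}) :
  perm_eq r (enum H) -> size m = #|H| ->
  chromatic_sym H m = word_series (fun w =>
    [forall x, forall y, adj x y ==>
       (nth 0%N w (index x r) != nth 0%N w (index y r))]%:R) m.
Proof.
move=> rH sm; have memr x : x \in r by rewrite (perm_mem rH) mem_enum.
have ur : uniq r by rewrite (perm_uniq rH) enum_uniq.
have sr : size r = size m by rewrite (perm_size rH) -cardE.
rewrite /chromatic_sym coef_word_series.
set A := [set kappa | _].
pose Q w := [forall x, forall y, adj x y ==>
       (nth 0%N w (index x r) != nth 0%N w (index y r))].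
rewrite -[RHS](natr_sum _ _ _ (fun w => nat_of_bool (Q w))).
rewrite -big_mkcond -big_filter sum1_size cardE; congr _%:R.
pose phi (k : {ffun H -> finsupp m}) := [seq val (k x) | x <- r].
have nth_phi k x : nth 0%N (phi k) (index x r) = val (k x).
  by rewrite (nth_map x) ?index_mem ?nth_index.
have phiI : injective phi.
  by move=> k k' e; apply/ffunP => x; apply: val_inj; rewrite -!nth_phi e.
have propE (k : {ffun H -> finsupp m}) : proper_coloring k = Q (phi k).
  rewrite /proper_coloring /Q; apply: eq_forallb => x; apply: eq_forallb => y.
  by rewrite !nth_phi.
rewrite -(size_map phi); apply: perm_size; apply: uniq_perm.
- by rewrite map_inj_uniq ?enum_uniq.
- by rewrite filter_uniq ?permutations_uniq.
move=> w; rewrite mem_filter mem_permutations.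
have perm_phi (k : {ffun H -> finsupp m}) :
    (seq_mset [seq val (k u) | u : H] == m) = perm_eq (phi k) m.
  rewrite -[X in _ == X]seq_mset_id; apply/eqP/idP => [/eq_seq_msetP pm|pm].
    by rewrite (permPl (perm_map _ rH)).
  by apply/eq_seq_msetP; rewrite -(permPl (perm_map _ rH)).
apply/mapP/andP => [[k]|[Qw wm]].
  by rewrite mem_enum inE propE perm_phi => /andP[Qk km] ->.
have wP x : nth 0%N w (index x r) \in finsupp m.
  by rewrite msuppE -(perm_mem wm) mem_nth // (perm_size wm) -sr index_mem.
pose k : {ffun H -> finsupp m} := [ffun x => [` wP x]].
have phik : phi k = w.
  apply: (@eq_from_nth _ 0%N) => [|i]; rewrite size_map sr ?(perm_size wm) // => im.
  case def_r: r => [|x0 r']; first by rewrite -sr def_r in im.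
  have ->: i = index (nth x0 r i) r by rewrite index_uniq ?sr.
  by rewrite nth_phi ffunE.
by exists k; rewrite ?phik // mem_enum inE propE perm_phi phik Qw.
Qed.

Lemma fcycle_enum_ordS n : fcycle (@ordS n.+1) (enum 'I_n.+1).
Proof.
have vcyc : cycle (fun i j => i.+1 %% n.+1 == j)%N (map val (enum 'I_n.+1)).
  rewrite val_enum_ord /= rcons_path; apply/andP; split.
    apply/(pathP 0%N) => i; rewrite size_iota => lt_in.
    rewrite nth_iota // -[0%N :: _]/(iota 0 n.+1) nth_iota ?leqW //.
    by rewrite add0n modn_small // add1n.
  rewrite (last_nth 0%N) -[0%N :: _]/(iota 0 n.+1) size_iota nth_iota //.
  by rewrite add0n modnn.
by move: vcyc; rewrite cycle_map; apply: sub_cycle => i j.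
Qed.

Lemma cycle_fcycle (T : eqType) (f : T -> T) (e : rel T) (r : seq T) :
  fcycle f r -> cycle e r = all (fun x => e x (f x)) r.
Proof.
have pathE x p : fpath f x p -> path e x p = all (fun y => e y (f y)) (belast x p).
  by elim: p x => //= y p IH x /andP[/eqP-> /IH->].
by case: r => //= x p /pathE->; rewrite belast_rcons.
Qed.

(** Here [b] is the color of the new vertex and [a] that of [v], while [c] and [last c u] are the
    colors of the two neighbors of [v] on the cycle. *)
Definition twin_word (w : seq nat) : bool :=
  if w is b :: a :: c :: u then
    [&& cycle (fun x y => x != y) (a :: c :: u), b != a, b != c & b != last c u]
  else false.

Lemma chromatic_twin_cycle n (v : cycle_graph n) (m : {mset nat}) :
  size m = n.+4 ->
  chromatic_sym (twin_graph v) m = word_series (fun w => (twin_word w)%:R) m.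
Proof.
(* The cycle is listed starting from [v], so that the neighbors of [v] come second and last; the new
   vertex will be put in front. *)
move=> sm; pose r0 := rot v (enum 'I_n.+3).
have r0E : perm_eq r0 (enum 'I_n.+3) by rewrite perm_rot.
have ur0 : uniq r0 by rewrite rot_uniq enum_uniq.
have szr0 : size r0 = n.+3 by rewrite size_rot size_enum_ord.
have cyc0 : fcycle (@ordS n.+3) r0 by rewrite rot_cycle fcycle_enum_ordS.
have memr0 x : x \in r0 by rewrite (perm_mem r0E) mem_enum.
have [x [p [def_r0 ord_x]]] : exists x, exists p,
    r0 = v :: x :: p /\ ordS (last x p) = v /\ ordS v = x.
  have : nth v r0 0 = v.
    by rewrite /r0 /rot nth_cat size_drop size_enum_ord subn_gt0 ltn_ord nth_drop
       addn0 nth_ord_enum.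
  move: szr0 cyc0; case: (r0) => [|v' [|x p]] //= _.
  rewrite rcons_path => /and3P[/eqP h1 _ /eqP h2] v'v.
  by exists x, p; rewrite -{1 2 3}v'v h2 -h1 v'v.
case: ord_x => [last_x ordS_v].
rewrite (@chromatic_words (twin_graph v) (None :: map Some r0)); first last.
- by rewrite sm /= card_option card_ord.
- apply: uniq_perm; rewrite ?enum_uniq //=.
    by rewrite map_inj_uniq ?ur0 ?andbT; [apply/mapP => -[]|move=> ? ? []].
  move=> [y|]; rewrite mem_enum !inE //=.
  by rewrite mem_map ?memr0 // => ? ? [].
apply: eq_in_word_series => -[|b w] /perm_size; rewrite sm // => -[sw].
congr (nat_of_bool _)%:R.
pose g (j : 'I_n.+3) := nth 0%N w (index j r0).
have nthE j : nth 0%N (b :: w) (index (Some j) (None :: map Some r0)) = g j.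
  by rewrite /= index_map // => ? ? [].
have nthN : nth 0%N (b :: w) (index None (None :: map Some r0)) = b by [].
have wE : w = map g r0.
  apply: (@eq_from_nth _ 0%N) => [|i]; rewrite ?size_map ?szr0 // sw => im.
  by rewrite (nth_map v) ?szr0 // /g index_uniq // szr0.
have cycE : cycle (fun x y => x != y) w = [forall j, g j != g (ordS j)].
  rewrite wE cycle_map (cycle_fcycle _ cyc0); apply/allP/forallP => [h j|h j _].
    exact: (h j (memr0 j)).
  exact: (h j).
have -> : twin_word (b :: w) =
    [&& cycle (fun x y => x != y) w, b != g v, b != g x & b != g (last x p)].
  by rewrite wE def_r0 /= last_map.
rewrite cycE; apply/forallP/and4P => [h|[/forallP hc bv bx bl] y].
  have hSS i j : cycle_adj i j -> g i != g j.
    by move=> ij; have /forallP/(_ (Some j)) := h (Some i); rewrite !nthE => /implyP/(_ ij).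
  have hN j : (j == v) || cycle_adj v j -> b != g j.
    by move=> ij; have /forallP/(_ (Some j)) := h None; rewrite nthN nthE => /implyP/(_ ij).
  split; first by apply/forallP => j; apply: hSS; rewrite /cycle_adj /= eqxx.
  - by apply: hN; rewrite eqxx.
  - by apply: hN; rewrite /cycle_adj /= ordS_v eqxx orbT.
  - by apply: hN; rewrite /cycle_adj /= last_x eqxx !orbT.
have hN j : (j == v) || cycle_adj v j -> b != g j.
  rewrite /cycle_adj /= => /or3P[/eqP-> //||].
    by rewrite ordS_v => /eqP->.
  by rewrite -{1}last_x => /eqP/ordS_inj <-.
apply/forallP => z; case: y z => [i|] [j|]; rewrite ?nthE ?nthN; apply/implyP => //=.
- by case/orP => /eqP->; [apply: hc | rewrite eq_sym; apply: hc].
- by move=> /hN; rewrite eq_sym.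
- exact: hN.
Qed.

(** * Symmetries of words and the reduction of the twin condition *)

Definition swap2 (w : seq nat) : seq nat :=
  if w is a :: b :: u then b :: a :: u else w.

Lemma word_series_swap2 Q : word_series (fun w => Q (swap2 w)) = word_series Q.
Proof.
apply/esym/word_series_perm => [|[|a [|b u]] //=].
  by apply: (can_inj (g := swap2)) => -[|a [|b u]].
by apply/permP => q /=; rewrite addnCA.
Qed.

Lemma word_series_rot k Q : word_series (fun w => Q (rot k w)) = word_series Q.
Proof.
apply/esym/word_series_perm => [|w]; first exact: rot_inj.
by rewrite perm_rot.
Qed.

Lemma word_series_cons K (Q : seq nat -> rat) : Q [::] = 0 ->
  agree K (word_series Q)
    (\sum_(s <- K) fps_var s * word_series (fun w => Q (s :: w)) : fps).
Proof.
move=> Q0 m mK; pose Qs s w := (starts s w)%:R * Q w.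
transitivity ((\sum_(s <- K) word_series (Qs s)) m); last first.
  congr (_ m); apply: eq_bigr => s _; rewrite [LHS](word_series_starts (s := s)).
    apply: (congr1 (fun f : fps => fps_var s * f)).
    by apply: eq_word_series => w; rewrite /Qs /starts /= eqxx mul1r.
  by move=> w /negbTE; rewrite /Qs => ->; rewrite mul0r.
rewrite coef_fps_sum coef_word_series.
under [RHS]eq_bigr do rewrite coef_word_series.
rewrite exchange_big /=; apply: eq_big_seq => -[|a w].
  by rewrite Q0 big1 // /Qs => s _; rewrite mul0r.
rewrite mem_permutations => /perm_mem/(_ a); rewrite mem_head => /esym am.
by rewrite big_fset_pick //; apply: (fsubsetP mK); rewrite msuppE.
Qed.

(** Viewing [x_s] as the degree 1 part of a [sets_series] lets the expansion of [e_1] follow from a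
    sum already computed; the degree 2 analogue does the same for [e_2]. *)
Lemma coef_fps_var s m : fps_var s m = (size m == 1%N)%:R * sets_series [:: s] [::] m.
Proof.
rewrite fps_var.unlock coef_sets_series /= !andbT -natrM mulnb; congr (nat_of_bool _)%:R.
apply/eqP/and3P => [->|[/eqP sz um sm]]; first by rewrite enum_msetn in_mset1 /=.
apply/eqP; rewrite -[m](msetB1K sm) (_ : m `\ s = mset0) ?msetD0 //.
by apply/eqP; rewrite -size_mset_eq0 size_msetB ?msub1set // sz enum_msetn.
Qed.

Lemma coef_fps_var2 s t m : s != t ->
  (fps_var s * fps_var t) m = (size m == 2%N)%:R * sets_series [:: t; s] [::] m.
Proof.
move=> st; rewrite coef_varM coef_fps_var !coef_sets_series /= !andbT.
case: (boolP (s \in m)) => sm; last by rewrite !andbF mulr0.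
have tE : (t \in m `\ s) = (t \in m) by rewrite in_msetB1 eq_sym (negbTE st).
rewrite size_msetB ?msub1set // enum_msetn /= tE -!natrM !mulnb.
congr (nat_of_bool _)%:R; rewrite !andbT.
have -> : (size m - 1 == 1)%N = (size m == 2%N).
  have : size m != 0%N.
    by rewrite size_mset_eq0; apply: contraTneq sm => ->; rewrite in_mset0.
  by move: (size m) => k; lia.
case: (eqVneq (size m)) => //= sz; case: (boolP (t \in m)) => tm; rewrite ?andbF // !andbT.
have mE : m = [mset s] `+` [mset t].
  rewrite -[LHS](msetB1K sm) -(msetB1K (_ : t \in m `\ s)) ?tE //.
  rewrite (_ : m `\ s `\ t = mset0) ?msetD0 //.
  apply/eqP; rewrite -size_mset_eq0 !size_msetB ?msub1set ?tE // sz.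
  by rewrite !enum_msetn.
rewrite mE msetDKB enum_msetn /=; apply/esym/mset_uniqP => x.
rewrite msetE2 !msetnE; case: (eqVneq x s) => [->|]; first by rewrite (negbTE st).
by case: ifP.
Qed.

Lemma esym1_sum K : agree K (Defs.esym 1) (\sum_(s <- K) fps_var s).
Proof.
move=> m mK; rewrite coef_fps_sum; under eq_bigr do rewrite coef_fps_var.
have := sets_series1_sum mK; rewrite coef_fps_sum -big_distrr /= => ->.
rewrite /Defs.esym coef_esym_series.
by rewrite andbC; case: eqP => [->|_]; rewrite ?mul0r // mul1r mulr1.
Qed.

Lemma esym2_sum K : agree K (Defs.esym 2 *+ 2)
  (\sum_(s <- K) \sum_(t <- K | s != t) fps_var s * fps_var t).
Proof.
move=> m mK; rewrite coef_fps_muln coef_fps_sum.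
transitivity (\sum_(s <- K) (size m == 2%N)%:R *
   (\sum_(t <- K | s != t) sets_series [:: t; s] [::]) m : rat); last first.
  apply: eq_bigr => s _; rewrite !coef_fps_sum big_distrr /=.
  by apply: eq_bigr => t st; rewrite coef_fps_var2.
have := sets_series2_sum mK; rewrite coef_fps_sum -big_distrr /= => ->.
rewrite /Defs.esym coef_esym_series.
rewrite andbC; case: eqP => [->|_]; rewrite ?mul0r ?mul0rn // mul1r -mulr_natr.
by case: uniq => /=; ring.
Qed.

(** The first letter is free and contributes [e_1]. The empty word is its own [behead] without
    having a first letter, hence the condition on [q]. *)
Lemma word_series_behead (q : pred (seq nat)) : ~~ q [::] ->
  word_series (fun w => (q (behead w))%:R)
  = Defs.esym 1 * word_series (fun w => (q w)%:R) :> fps.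
Proof.
move=> q0; apply: agree_all => K m mK.
rewrite (agreeM (@esym1_sum K) (@agree_refl K _) mK) mulr_suml.
by rewrite (word_series_cons (K := K)) //= (negbTE q0).
Qed.

Definition head2_neq (w : seq nat) : bool := if w is b :: a :: _ then b != a else false.

(** The first two letters form any ordered pair of distinct letters, which contributes [2 e_2]. *)
Lemma word_series_head2_neq (q : pred (seq nat)) :
  word_series (fun w => (head2_neq w && q (behead (behead w)))%:R)
  = Defs.esym 2 *+ 2 * word_series (fun w => (q w)%:R) :> fps.
Proof.
apply: agree_all => K m mK.
rewrite (agreeM (@esym2_sum K) (@agree_refl K _) mK) mulr_suml.
rewrite (word_series_cons (K := K)) //= !coef_fps_sum; apply: eq_bigr => s _.
have := agreeM (@agree_refl K (fps_var s)) (word_series_cons (K := K) (Q := fun w =>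
  (head2_neq (s :: w) && q (behead w))%:R) _) mK.
rewrite /= => ->; rewrite // mulr_sumr mulr_suml; congr (_ m).
rewrite [RHS]big_mkcond; apply: eq_bigr => t _; rewrite -mulrA; case: eqP => _ /=.
  rewrite (_ : word_series _ = 0) ?mulr0 //; apply: funext => m'.
  by rewrite coef_word_series big1.
by [].
Qed.

Lemma ohead_rev (x : nat) u : ohead (rev (x :: u)) = Some (last x u).
Proof. by case/lastP: u => [|u y] //; rewrite last_rcons -rcons_cons rev_rcons. Qed.

(** Write [w] as [b a c u] with last letter [l]. For [a <> b], the product of [[a<>c] + [b<>c] - 1]
    and [[a<>l] + [b<>l] - 1] has nine terms. The cross terms are cyclic words [w] and [swap2 w],
    the terms with a single condition are Carlitz words, and the constant term is the [head2_neq]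
    one. The terms in [a] alone or [b] alone are cyclic words with one letter fewer; their part with
    [a = b] is removed by the differences in [rot 1]. *)
Lemma twin_word_expansion w : (3 <= size w)%N ->
  (twin_word w)%:R =
  (cyclic_carlitz w)%:R + (cyclic_carlitz (swap2 w))%:R
  + ((cyclic_carlitz (behead w))%:R + (cyclic_carlitz (behead (swap2 w)))%:R)
  - ((carlitz (rot 1 w))%:R - (cyclic_carlitz (rot 1 w))%:R)
  - ((carlitz (rot 1 (swap2 w)))%:R - (cyclic_carlitz (rot 1 (swap2 w)))%:R)
  - (carlitz w)%:R - (carlitz (swap2 w))%:R
  - (carlitz (rot 2 w))%:R - (carlitz (rot 2 (swap2 w)))%:R
  + (head2_neq w && carlitz (behead (behead w)))%:R :> rat.
Proof.
case: w => [|b [|a [|c u]]] // _.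
rewrite /cyclic_carlitz /rot /= ?drop0 ?take0 -!cats1 -?catA /= !ohead_rev /carlitz /=.
have SomeE (x y : nat) : (Some x == Some y) = (x == y) by [].
rewrite !last_cat /= !cat_path /= !andbT !SomeE; move: (last c u) => l.
rewrite [l == a]eq_sym [l == b]eq_sym [a == b]eq_sym.
case: (path _ c u); rewrite ?andbF ?andbT /=; last by ring.
have [->|ba] := eqVneq b a; first by case: (a == c); case: (a == l) => /=; ring.
(* As [a] and [b] differ, they cannot both equal [c], nor both equal [l]; this excludes the cases
   where inclusion-exclusion would fail. *)
have hc : ~~ ((a == c) && (b == c)) by apply: contraNN ba => /andP[/eqP-> /eqP->].
have hl : ~~ ((a == l) && (b == l)) by apply: contraNN ba => /andP[/eqP-> /eqP->].
move: hc hl; case: (a == c); case: (b == c); case: (a == l); case: (b == l) => //= _ _.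
all: by ring.
Qed.

(** Swapping the first two letters and rotating preserve the monomial of a word, so the summands of
    [twin_word_expansion] collapse to multiples of four series. *)
Lemma twin_cycle_series n (v : cycle_graph n) (m : {mset nat}) :
  size m = n.+4 ->
  chromatic_sym (twin_graph v) m =
  2 * (Defs.esym 2 * path_series + Defs.esym 1 * cycle_series
       + cycle_series *+ 2 - path_series *+ 3 : fps) m.
Proof.
move=> sm; rewrite chromatic_twin_cycle //.
have le3 w : perm_eq w m -> (3 <= size w)%N by move/perm_size->; rewrite sm.
rewrite (eq_in_word_series (fun w wm => twin_word_expansion (le3 w wm))).
rewrite !(word_seriesD, word_seriesN).
rewrite !(word_series_swap2 (fun w => (cyclic_carlitz w)%:R)).
rewrite !(word_series_swap2 (fun w => (carlitz w)%:R)).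
rewrite !(word_series_swap2 (fun w => (cyclic_carlitz (behead w))%:R)).
rewrite !(word_series_swap2 (fun w => (cyclic_carlitz (rot 1 w))%:R)).
rewrite !(word_series_swap2 (fun w => (carlitz (rot 1 w))%:R)).
rewrite !(word_series_swap2 (fun w => (carlitz (rot 2 w))%:R)).
rewrite !(word_series_rot _ (fun w => (cyclic_carlitz w)%:R)).
rewrite !(word_series_rot _ (fun w => (carlitz w)%:R)).
rewrite word_series_behead // word_series_head2_neq -/path_series -/cycle_series.
rewrite mulr_natl -coef_fps_muln; apply: (congr1 (fun f : fps => f m)); ring.
Qed.

(** * Expansions in elementary symmetric functions *)

Lemma seq_mset0 : seq_mset [::] = mset0 :> {mset nat}.
Proof. by rewrite -[RHS]seq_mset_id enum_mset0. Qed.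

Lemma weightE (la : {mset nat}) (s : seq nat) :
  perm_eq la s -> weight la = (\sum_(j <- s) j)%N.
Proof. by move=> p; rewrite /weight (perm_big _ p). Qed.

Lemma weightD (a b : {mset nat}) : weight (a `+` b) = (weight a + weight b)%N.
Proof.
rewrite /weight -big_cat; exact/perm_big/perm_msetD.
Qed.

Lemma weight1 k : weight [mset k] = k.
Proof. by rewrite /weight enum_msetn big_seq1. Qed.

Lemma weightB1 k (la : {mset nat}) : k \in la -> weight la = (k + weight (la `\ k))%N.
Proof. by move=> kla; rewrite -{1}(msetB1K kla) weightD weight1. Qed.

Lemma esym_part_ind (R : fps -> {mset nat} -> Prop) :
  R 1 mset0 -> (forall k f la, R f la -> R (Defs.esym k * f) (k +` la)) ->
  forall la, R (esym_part la) la.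
Proof.
move=> R0 RS la; rewrite esym_partE -{2}[la]seq_mset_id.
elim: (la : seq nat) => [|k s IH]; last by rewrite big_cons mset_cons; apply: RS.
by rewrite big_nil seq_mset0.
Qed.

Lemma esym_part_homog (la m : {mset nat}) :
  esym_part la m != 0 -> size m = weight la.
Proof.
move: m; apply: (esym_part_ind (R := fun f la =>
  forall m, f m != 0 -> size m = weight la)) la => [m|k f la IH m].
  rewrite coef_fps1 /weight enum_mset0 big_nil.
  by case: (eqVneq m mset0) => [->|]; rewrite ?size_mset0 ?eqxx.
apply: contra_neq_eq => sm; rewrite coef_fpsM big_seq big1 // => a.
rewrite in_divisors_monom /Defs.esym => am.
case: eqP => [sa|]; rewrite ?andbF ?mul0r // andbT.
rewrite (_ : f _ = 0) ?mulr0 //; apply: contra_neq_eq sm => fa; apply/eqP.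
have := msubset_size am; rewrite weightD weight1 -(IH _ fa) size_msetB //; lia.
Qed.

(** The infinite sum of the [c la * e_la]: by homogeneity only the partitions of the degree of [m]
    contribute at [m]. *)
HB.lock Definition e_series (c : {mset nat} -> rat) : fps := fun m =>
  \sum_(la <- partitions (size m)) c la * esym_part la m.

Lemma coef_e_series c m :
  e_series c m = \sum_(la <- partitions (size m)) c la * esym_part la m.
Proof. by rewrite e_series.unlock. Qed.

Lemma eq_in_e_series c c' (m : {mset nat}) :
  (forall la, is_partition la -> weight la = size m -> c la = c' la) ->
  e_series c m = e_series c' m.
Proof.
move=> cc; rewrite !coef_e_series; apply: eq_big_seq => la.
by rewrite in_partitions => /andP[? /eqP ?]; rewrite cc.
Qed.

Lemma eq_e_series c c' :
  (forall la, is_partition la -> c la = c' la) -> e_series c = e_series c'.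
Proof. by move=> cc; apply: funext => m; apply: eq_in_e_series => la /cc. Qed.

Lemma e_seriesD c c' : e_series (fun la => c la + c' la) = e_series c + e_series c'.
Proof.
apply: funext => m; rewrite coef_fpsD !coef_e_series -big_split.
by apply: eq_bigr => la _; rewrite /= mulrDl.
Qed.

(** Adding a part [k] is a bijection from the partitions of [n - k] onto the partitions of [n] that
    have [k] as a part. *)
Lemma esym_mul_e_series k c : (0 < k)%N ->
  Defs.esym k * e_series c
  = e_series (fun la => if k \in la then c (la `\ k) else 0).
Proof.
move=> k0; apply: funext => m; rewrite coef_e_series.
transitivity (\sum_(mu <- partitions (size m - k) | (k <= size m)%N)
                 c mu * (Defs.esym k * esym_part mu : fps) m).
  rewrite coef_fpsM; under [RHS]eq_bigr do rewrite coef_fpsM big_distrr.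
  rewrite exchange_big /=; apply: eq_big_seq => a; rewrite in_divisors_monom => am.
  rewrite /Defs.esym; case: (eqVneq (size (a : {mset nat})) k) => [sa|]; last first.
    by rewrite andbF mul0r big1 // => mu _; rewrite mul0r mulr0.
  have km : (k <= size m)%N by rewrite -sa msubset_size.
  rewrite coef_e_series size_msetB // sa km big_distrr /=.
  by apply: eq_bigr => mu _; rewrite mulrCA.
transitivity (\sum_(la <- partitions (size m) | k \in (la : {mset nat}))
                 c (la `\ k) * esym_part la m); last first.
  by rewrite big_mkcond; apply: eq_bigr => la _; case: ifP; rewrite ?mul0r.
case: leqP => km; last first.
  rewrite big_pred0_eq big_seq_cond big1 // => la; rewrite in_partitions.
  by case/andP=> /andP[_ /eqP] wla /weightB1; lia.
transitivity (\sum_(la <- [seq k +` mu | mu <- partitions (size m - k)])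
                 c (la `\ k) * esym_part la m).
  rewrite big_map; apply: eq_bigr => mu _.
  by rewrite msetDKB esym_partD esym_part1.
rewrite -[RHS]big_filter; apply: perm_big; apply: uniq_perm.
- by rewrite map_inj_uniq ?fset_uniq // => x y e; rewrite -[x](msetDKB [mset k]) e msetDKB.
- by rewrite filter_uniq ?fset_uniq.
move=> la; rewrite mem_filter; apply/mapP/andP => [[mu]|[kla]].
  rewrite !in_partitions /is_partition => /andP[mu0 /eqP wmu] ->.
  rewrite in_mset1D eqxx !in_mset1D weightD weight1 wmu subnKC // eqxx andbT.
  by split=> //; rewrite negb_or mu0 andbT; move: k0; case: (k).
rewrite !in_partitions /is_partition => /andP[la0 /eqP wla].
exists (la `\ k); last by rewrite msetB1K.
rewrite in_partitions /is_partition (contra _ la0) /=; last first.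
  exact/msubset_subset/msubsetDl.
by rewrite -wla (weightB1 kla) addKn.
Qed.

Lemma coef_esym_seriesM a (f : fps) m :
  (esym_series a * f) m = \sum_(k < (size m).+1) a k * (Defs.esym k * f : fps) m.
Proof.
under [RHS]eq_bigr do rewrite coef_fpsM big_distrr.
rewrite coef_fpsM exchange_big /=; apply: eq_big_seq => d.
rewrite in_divisors_monom => dm; have := msubset_size dm; rewrite -ltnS => sd.
rewrite coef_esym_series (bigD1 (Ordinal sd)) //= big1 ?addr0 => [|k].
  by rewrite /Defs.esym eqxx andbT mulrCA mulrA.
rewrite -val_eqE /= eq_sym /Defs.esym => /negbTE->.
by rewrite andbF mul0r mulr0.
Qed.

(** The condition on [a 0] discards [e_0], which does not correspond to removing a part. Since only
    parts of [la] contribute, the sum over degrees becomes a sum over the support. *)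
Lemma esym_series_mul_e_series (a : nat -> rat) c : a 0%N = 0 ->
  esym_series a * e_series c = e_series (fun la =>
    \sum_(k <- finsupp la) a k * (if k \in la then c (la `\ k) else 0)).
Proof.
move=> a0; apply: funext => m; rewrite coef_esym_seriesM big_ord_recl a0 mul0r add0r.
under eq_bigr do rewrite esym_mul_e_series // coef_e_series big_distrr.
rewrite exchange_big coef_e_series /=; apply: eq_big_seq => la.
rewrite in_partitions => /andP[la0 /eqP wla].
rewrite big_distrl /=; under eq_bigr do rewrite mulrA.
rewrite -(big_mkord predT (fun i => a i.+1 *
  (if i.+1 \in (la : {mset nat}) then c (la `\ i.+1) else 0) * esym_part la m)).
rewrite -(big_add1 _ _ 0 (size m).+1 predT (fun i => a i *
  (if i \in (la : {mset nat}) then c (la `\ i) else 0) * esym_part la m)).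
rewrite (bigID (mem (la : {mset nat}))) /= [X in _ + X]big1 ?addr0; last first.
  by move=> k /negbTE->; rewrite mulr0 mul0r.
rewrite -big_filter; apply: perm_big; apply: uniq_perm.
- by rewrite filter_uniq ?iota_uniq.
- exact: fset_uniq.
move=> k; rewrite mem_filter mem_index_iota msuppE.
case: (boolP (k \in (la : {mset nat}))) => //= kla.
rewrite ltnS -wla (weightB1 kla) leq_addr andbT.
by rewrite lt0n; apply: contraNneq la0 => <-.
Qed.

(** * The recursion for epsilon *)

Lemma eps_finsuppS (K : {fset nat}) (la : {mset nat}) : (finsupp la `<=` K)%fset ->
  eps la = (size la)`!%:R * \prod_(j <- K) ((j%:R - 1) ^+ la j / (la j)`!%:R).
Proof.
move=> laK; rewrite /eps; congr (_ * _); apply: big_fset_incl => // j _.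
by rewrite msuppE => /mset_eq0P->; rewrite expr0 fact0 divr1.
Qed.

(** Restoring the part [k] multiplies the factorial by the length of [la], and the product by
    [k - 1] over the multiplicity of [k]. *)
Lemma eps_remove (k : nat) (la : {mset nat}) : k \in la ->
  (k%:R - 1) * eps (la `\ k) * (size la)%:R = (la k)%:R * eps la.
Proof.
move=> kla; have kK : k \in finsupp la by rewrite msuppE.
rewrite (@eps_finsuppS (finsupp la) (la `\ k)); last exact/finsuppS/msubsetDl.
rewrite /eps !(big_fsetD1 k kK) /= msetB1E eqxx.
rewrite size_msetB ?msub1set // enum_msetn subn1.
have -> : \prod_(j <- (finsupp la `\ k)%fset)
    ((j%:R - 1) ^+ (la `\ k) j / ((la `\ k) j)`!%:R)
  = \prod_(j <- (finsupp la `\ k)%fset) ((j%:R - 1) ^+ la j / (la j)`!%:R) :> rat.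
  apply: eq_big_seq => j; rewrite !inE => /andP[/negbTE jk _].
  by rewrite msetB1E jk subn0.
set Z := \prod_(j <- _) _.
have : (0 < la k)%N by rewrite mset_gt0.
have : (0 < size la)%N.
  by rewrite lt0n size_mset_eq0; apply: contraTneq kla => ->; rewrite in_mset0.
case: (size la) => // n _; case: (la k) => // l _.
rewrite /= subn1 /= !factS !natrM exprS.
have l0 : l`!%:R != 0 :> rat by rewrite pnatr_eq0 -lt0n fact_gt0.
have l1 : l.+1%:R != 0 :> rat by rewrite pnatr_eq0.
by field; rewrite l0 -mulrS.
Qed.

(** Sum [eps_remove] over the support: the multiplicities add up to the length, which is then
    cancelled. *)
Lemma eps_rec (la : {mset nat}) : la != mset0 ->
  eps la = \sum_(k <- finsupp la) (k%:R - 1) * eps (la `\ k).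
Proof.
move=> la0; have s0 : (size la)%:R != 0 :> rat by rewrite pnatr_eq0 size_mset_eq0.
apply: (mulIf s0); rewrite big_distrl /= mulrC {1}size_mset natr_sum big_distrl /=.
by apply: eq_big_seq => k; rewrite msuppE => /eps_remove->.
Qed.

Lemma eps_rem0 la : eps_rem la [::] = eps la.
Proof.
by rewrite /eps_rem seq_mset0 msub0set msetB0.
Qed.

(** Here [k] is removed last, as the recursion at [la - s] requires; [eps_rem_behead] removes it
    first, as multiplication by [e_k] requires. *)
Lemma eps_rem_cons la k s : eps_rem la (k :: s) =
  if (seq_mset s `<=` la) && (k \in la `\` seq_mset s)
  then eps (la `\` seq_mset s `\ k) else 0.
Proof.
rewrite /eps_rem mset_cons msetDC msetBDA.
congr (if _ then _ else _); apply/msubsetP/andP => [h|[/msubsetP h kla] x].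
  split; first by apply/msubsetP => x; have := h x; rewrite msetE2; lia.
  by rewrite in_mset msetE2; have := h k; rewrite msetE2 msetnE eqxx; lia.
move: kla; rewrite in_mset !msetE2 msetnE; have := h x.
by case: eqP => [->|_]; lia.
Qed.

Lemma eps_rem_behead la k s :
  eps_rem la (k :: s) = if k \in la then eps_rem (la `\ k) s else 0.
Proof.
rewrite {1}/eps_rem mset_cons msetBDA /eps_rem; case: ifP => kla.
  have kin : k \in la.
    by move/msubsetP/(_ k): kla; rewrite msetE2 msetnE eqxx in_mset; lia.
  rewrite kin ifT //; apply/msubsetP => x; move/msubsetP/(_ x): kla.
  by rewrite !msetE2; lia.
case: ifP => // kin; rewrite ifF //; apply/negbTE; apply: contraFN kla => /msubsetP h.
apply/msubsetP => x; have := h x; rewrite !msetE2 msetnE.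
by move: kin; rewrite in_mset; case: eqP => [->|_]; lia.
Qed.

(** This is [eps_rec] at [la - s], which the hypothesis keeps from being empty; if [s] cannot be
    removed, both sides vanish by convention. *)
Lemma eps_rem_rec la s : la != seq_mset s ->
  eps_rem la s = \sum_(k <- finsupp la) (k%:R - 1) * eps_rem la (k :: s).
Proof.
move=> neq; under eq_bigr do rewrite eps_rem_cons.
rewrite /eps_rem; case: ifP => sla; last by rewrite big1 // => k _; rewrite mulr0.
rewrite eps_rec; last first.
  apply: contraNneq neq => /eqP; rewrite msetB_eq0 => las.
  by rewrite eqEmsubset las sla.
rewrite -(@big_fset_incl _ _ _ _ _ _ _ (finsuppS (msubsetDl la (seq_mset s)))) /=.
  by apply: eq_big_seq => k; rewrite msuppE => ->.
by move=> k _; rewrite msuppE => /negbTE->; rewrite mulr0.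
Qed.

(** * The inverse of [E_ - E1_] and the expansion of the twin series *)

Local Notation rem_series s := (e_series (fun la => eps_rem la s)).

Lemma esym_mul_rem_series k s : (0 < k)%N ->
  Defs.esym k * rem_series s = rem_series (k :: s).
Proof.
move=> k0; rewrite esym_mul_e_series //; apply: eq_e_series => la _.
by rewrite eps_rem_behead.
Qed.

Lemma esym_series_mul_rem_series (a : nat -> rat) s : a 0%N = 0 ->
  esym_series a * rem_series s =
  e_series (fun la => \sum_(k <- finsupp la) a k * eps_rem la (k :: s)).
Proof.
move=> a0; rewrite esym_series_mul_e_series //; apply: eq_e_series => la _.
by apply: eq_bigr => k _; rewrite eps_rem_behead.
Qed.

Lemma eq_esym_series a b : a =1 b -> esym_series a = esym_series b.
Proof. by move=> ab; apply: funext => m; rewrite !coef_esym_series ab. Qed.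

Lemma esym_seriesD a b :
  esym_series (fun k => a k + b k) = esym_series a + esym_series b.
Proof. by apply: funext => m; rewrite coef_fpsD !coef_esym_series mulrDr. Qed.

Lemma esym_seriesN a : esym_series (fun k => - a k) = - esym_series a.
Proof. by apply: funext => m; rewrite coef_fpsN !coef_esym_series mulrN. Qed.

Lemma esym_series_delta0 : esym_series (fun k => (k == 0%N)%:R) = 1.
Proof.
apply: funext => m; rewrite coef_esym_series coef_fps1 size_mset_eq0.
by case: eqP => [->|]; rewrite ?mulr0 // enum_mset0 mulr1.
Qed.

Lemma e_series_delta0 : e_series (fun la => (la == mset0)%:R) = 1.
Proof.
apply: funext => m; rewrite coef_e_series coef_fps1.
case: (eqVneq m mset0) => [->|m0].
  rewrite (big_fsetD1 mset0) /=; last first.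
    by rewrite in_partitions /is_partition in_mset0 /weight enum_mset0 big_nil.
  rewrite eqxx mul1r esym_partE enum_mset0 big_nil coef_fps1 eqxx.
  by rewrite big1_fset ?addr0 // => la; rewrite !inE => /andP[/negbTE-> _]; rewrite mul0r.
rewrite big_seq big1 // => la; rewrite in_partitions => /andP[_ /eqP wla].
case: eqP wla => [->|]; rewrite ?mul0r // /weight enum_mset0 big_nil => /esym/eqP.
by rewrite size_mset_eq0 (negbTE m0).
Qed.

(** As [E_ - E1_] is 1 minus the sum of the [(k - 1) e_k] over [k >= 1], the claim restates the
    recursion for [eps] with initial value [eps0]. *)
Lemma rem_series_inv : (E_ - E1_) * rem_series [::] = 1.
Proof.
have -> : E_ - E1_ = 1 - esym_series (fun k => (k != 0%N)%:R * (k%:R - 1)).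
  rewrite -esym_series_delta0 -!esym_seriesN -!esym_seriesD; apply: eq_esym_series => k.
  by case: k => [|k] /=; ring.
rewrite mulrBl mul1r esym_series_mul_rem_series ?mul0r //.
rewrite -e_series_delta0; apply/eqP; rewrite subr_eq -e_seriesD; apply/eqP.
apply: eq_e_series => la la0; case: (eqVneq la mset0) => [->|lan0].
  by rewrite finsupp0 big_seq_fset0 addr0 eps_rem0 eps0.
rewrite add0r eps_rem_rec; last first.
  by apply: contraNneq lan0 => ->; rewrite seq_mset0.
apply: eq_big_seq => k; rewrite msuppE => kla.
have -> : k != 0%N by apply: contraNneq la0 => <-.
by rewrite mul1r.
Qed.

(** The third sum and the last term together come from [e_2 E_]: the term [e_0] of [E_] is split off
    and gives the last term. *)
Definition twin_coef (la : {mset nat}) : rat :=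
  \sum_(k <- finsupp la) (2 * k%:R ^+ 2 - 5 * k%:R) * eps_rem la [:: k]
  + \sum_(k <- finsupp la) k%:R * (k%:R - 1) * eps_rem la [:: k; 1%N]
  + \sum_(k <- finsupp la) (k != 0%N)%:R * eps_rem la [:: k; 2%N]
  + eps_rem la [:: 2%N].

(** With [I] the inverse of [E_ - E1_], the path series is [E_ I = 1 + E1_ I] and the cycle series
    is [E2_ I]. The first form is used in the product with [e_2] and the second in the triple,
    whence the constant [-3]. *)
Lemma twin_series_expansion :
  Defs.esym 2 * path_series + Defs.esym 1 * cycle_series
       + cycle_series *+ 2 - path_series *+ 3 = e_series twin_coef - 3%:R :> fps.
Proof.
have inv := rem_series_inv; set I := rem_series [::] in inv.
have PE : path_series = E_ * I.
  by rewrite -path_seriesD mulrAC inv mul1r.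
have CE : cycle_series = E2_ * I.
  by rewrite -cycle_seriesD mulrAC inv mul1r.
rewrite /twin_coef !e_seriesD.
rewrite -(esym_series_mul_rem_series (a := fun k => 2 * k%:R ^+ 2 - 5 * k%:R)) //.
rewrite -(esym_series_mul_rem_series (a := fun k => k%:R * (k%:R - 1))) ?mul0r //.
rewrite -(esym_series_mul_rem_series (a := fun k => (k != 0%N)%:R)) //.
rewrite -!esym_mul_rem_series // -/I PE CE.
have EE : E_ = 1 + esym_series (fun k => (k != 0%N)%:R).
  rewrite -esym_series_delta0 -esym_seriesD; apply: eq_esym_series => k.
  by case: k => [|k] /=; ring.
have -> : esym_series (fun k => 2 * k%:R ^+ 2 - 5 * k%:R) = E2_ *+ 2 - E1_ *+ 3.
  rewrite !mulrS !mulr0n !addr0 -!(esym_seriesN, esym_seriesD).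
  by apply: eq_esym_series => k; ring.
have -> : esym_series (fun k => (k != 0%N)%:R) = E_ - 1 by rewrite EE; ring.
have EI : E_ * I = 1 + E1_ * I by rewrite -inv; ring.
transitivity (Defs.esym 2 * (E_ * I) + Defs.esym 1 * (E2_ * I) + (E2_ * I) *+ 2
              - (1 + E1_ * I) *+ 3 : fps); first by rewrite -EI.
ring.
Qed.

(** * Linear independence of the products of elementary symmetric functions *)

Lemma count_msetD (p : pred nat) (a b : {mset nat}) :
  count p (a `+` b) = (count p a + count p b)%N.
Proof. by rewrite -count_cat (permP (perm_msetD a b)). Qed.

(* The sum of the first i parts of the conjugate partition. *)
Definition conj_sum (la : {mset nat}) (i : nat) : nat := (\sum_(j <- la) minn j i)%N.

Lemma conj_sumD a b i : conj_sum (a `+` b) i = (conj_sum a i + conj_sum b i)%N.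
Proof.
rewrite /conj_sum -big_cat; exact/perm_big/perm_msetD.
Qed.

Lemma conj_sum1 k i : conj_sum [mset k] i = minn k i.
Proof. by rewrite /conj_sum enum_msetn big_seq1. Qed.

Lemma count_ltn_iota i k : count (fun x => x < i)%N (iota 0 k) = minn k i.
Proof. by elim: k => [|k IH]; rewrite ?min0n // -addn1 iotaD count_cat IH /=; lia. Qed.

Lemma count_ltn_uniq i (s : seq nat) : uniq s ->
  (count (fun x => x < i)%N s <= minn (size s) i)%N.
Proof.
move=> us; rewrite leq_min count_size -size_filter -[X in (_ <= X)%N](size_iota 0 i).
apply: uniq_leq_size; first by rewrite filter_uniq.
by move=> x; rewrite mem_filter mem_iota add0n => /andP[].
Qed.

(** Each factor [e_k] supplies a squarefree monomial of degree [k], in which at most [min(k, i)]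
    variables have index below [i]. *)
Lemma esym_part_support (la m : {mset nat}) i : esym_part la m != 0 ->
  (count (fun x => x < i)%N m <= conj_sum la i)%N.
Proof.
move: m; apply: (esym_part_ind (R := fun f la => forall m, f m != 0 ->
  (count (fun x => x < i)%N m <= conj_sum la i)%N)) la => [m|k f la IH m].
  rewrite coef_fps1; case: (eqVneq m mset0) => [->|]; rewrite ?eqxx //.
  by rewrite enum_mset0.
apply: contraNT; rewrite -ltnNge => lt_la; apply/eqP.
rewrite coef_fpsM big_seq big1 // => a; rewrite in_divisors_monom => am.
rewrite /Defs.esym; case: (boolP (uniq _)) => ua; rewrite ?mul0r //=.
case: eqP => sa; rewrite ?mul0r //.
have [->|/IH fa] := eqVneq (f (m `\` a)) 0; first by rewrite mulr0.
move: lt_la; rewrite -{1}(msetBDKC am) count_msetD conj_sumD conj_sum1.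
by have := count_ltn_uniq i ua; rewrite sa; lia.
Qed.

(** Take the variables of index [0, ..., k-1] from each factor [e_k]. All coefficients are
    nonnegative, so nothing cancels this contribution. *)
Lemma esym_part_leading (la : {mset nat}) : exists2 m : {mset nat},
  esym_part la m != 0 & forall i, count (fun x => x < i)%N m = conj_sum la i.
Proof.
suff [_ [m m0 mE]] : (forall m, 0 <= esym_part la m) /\ (exists2 m : {mset nat},
    0 < esym_part la m & forall i, count (fun x => x < i)%N m = conj_sum la i).
  by exists m; rewrite ?gt_eqF.
apply: (esym_part_ind (R := fun f la => (forall m, 0 <= f m) /\ (exists2 m : {mset nat},
    0 < f m & forall i, count (fun x => x < i)%N m = conj_sum la i))) la.
  split; first by move=> m; rewrite coef_fps1.
  exists mset0; first by rewrite coef_fps1 eqxx.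
  by move=> i; rewrite /conj_sum enum_mset0 big_nil.
move=> k f la [f0 [m fm mE]].
have t0 a b : 0 <= Defs.esym k a * f b by rewrite mulr_ge0.
split; first by move=> m'; rewrite coef_fpsM sumr_ge0.
have pI := perm_eq_seq_mset (iota 0 k).
exists (seq_mset (iota 0 k) `+` m) => [|i].
  rewrite coef_fpsM (big_fsetD1 (seq_mset (iota 0 k))) /=; last first.
    by rewrite in_divisors_monom; apply/msubsetP => x; rewrite msetE2 leq_addr.
  rewrite msetDKB ltr_pwDl ?sumr_ge0 //.
  by rewrite /Defs.esym (perm_uniq pI) (perm_size pI) iota_uniq size_iota eqxx mul1r.
by rewrite count_msetD conj_sumD mE conj_sum1 (permP pI) count_ltn_iota.
Qed.

Lemma conj_sumS la i :
  conj_sum la i.+1 = (conj_sum la i + count (fun j => i < j)%N la)%N.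
Proof.
rewrite /conj_sum -sum1_count [X in (_ + X)%N]big_mkcond -big_split /=.
apply: eq_bigr => j _.
by case: ltnP; lia.
Qed.

(** First differences in [i] count the parts larger than [i], and second differences are the
    multiplicities of the positive parts. *)
Lemma conj_sum_inj la mu : is_partition la -> is_partition mu ->
  (forall i, conj_sum la i = conj_sum mu i) -> la = mu.
Proof.
move=> la0 mu0 e; have cE i : count (fun j => i < j)%N la = count (fun j => i < j)%N mu.
  by have := conj_sumS mu i; rewrite -!e conj_sumS; lia.
have mE (nu : {mset nat}) i : (nu i.+1 + count (fun j => i.+1 < j) nu)%N
    = count (fun j => i < j)%N nu.
  rewrite -count_mem_mset -!sum1_count [RHS]big_mkcond.
  rewrite [X in (X + _)%N]big_mkcond [X in (_ + X)%N]big_mkcond -big_split.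
  apply: eq_bigr => j _ /=.
  by case: (eqVneq j i.+1); case: (ltnP i.+1 j); case: (ltnP i j); lia.
apply/msetP => -[|i]; first by rewrite !(mset_eq0P _).
by have := mE la i; have := mE mu i; rewrite (cE i) (cE i.+1) => <- /addIn.
Qed.

Lemma conj_sum_weight la i : (weight la <= i)%N -> conj_sum la i = weight la.
Proof.
move=> wi; rewrite /conj_sum /weight; apply: eq_big_seq => j jla.
by have := weightB1 (jla : j \in la); lia.
Qed.

Lemma conj_sum_le la i : (conj_sum la i <= weight la)%N.
Proof. by rewrite /conj_sum /weight leq_sum // => j _; rewrite geq_minl. Qed.

(** Triangularity: at the leading monomial of [la], every other [mu] that contributes has a larger
    conjugate in dominance order, and its coefficient vanishes by induction. *)
Lemma e_series_eq0 d : e_series d = 0 -> forall la, is_partition la -> d la = 0.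
Proof.
move=> d0 la; move: {2}(weight la) (erefl (weight la)) => n.
(* A numerical measure that increases strictly along dominance of conjugates; it is bounded on the
   partitions of [n], which permits a downward induction. *)
pose Phi nu := (\sum_(i < n.+1) conj_sum nu i)%N.
have Phi_le nu : weight nu = n -> (Phi nu <= n.+1 * n)%N.
  move=> wnu; rewrite /Phi -[X in (X * n)%N]card_ord -sum_nat_const leq_sum // => i _.
  by rewrite -[X in (_ <= X)%N]wnu conj_sum_le.
have [k] := ubnP (n.+1 * n - Phi la); elim: k la => // k IH la; rewrite ltnS => lek wla pla.
have [m m0 mE] := esym_part_leading la.
have sm : size m = n by rewrite (esym_part_homog m0).
have := congr1 (fun f : fps => f m) d0; rewrite coef_e_series sm => /=.
rewrite (big_fsetD1 la) ?in_partitions ?pla ?wla ?eqxx //= big1_fset.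
  by rewrite addr0 => /eqP; rewrite mulf_eq0 (negbTE m0) orbF => /eqP.
move=> mu; rewrite !inE in_partitions => /andP[mula /andP[pmu /eqP wmu]] _.
have [->|mum] := eqVneq (esym_part mu m) 0; first by rewrite mulr0.
have le i : (conj_sum la i <= conj_sum mu i)%N by rewrite -mE esym_part_support.
rewrite IH ?mul0r //; apply: leq_trans lek.
suff : (Phi la < Phi mu)%N by have := Phi_le mu wmu; lia.
(* If the two measures agreed, the termwise inequalities would all be equalities and force
   [mu = la]; from index [n] on both partial sums equal [n]. *)
rewrite ltn_neqAle leq_sum ?andbT //; apply: contraNneq mula => ePhi.
apply/eqP/conj_sum_inj => // i; case: (leqP n i) => ni.
  by rewrite !conj_sum_weight ?wla ?wmu.
have := leqif_sum (fun (i : 'I_n.+1) (_ : true) => leqif_eq (le i)).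
case=> _; rewrite -/(Phi la) -/(Phi mu) ePhi eqxx => /esym/forallP.
by move/(_ (Ordinal (leqW ni)))/eqP.
Qed.

(** * The coefficients *)

Lemma eps_rem_perm la s t : perm_eq s t -> eps_rem la s = eps_rem la t.
Proof. by move=> /eq_seq_msetP st; rewrite /eps_rem st. Qed.

Lemma eps_remC la a b : eps_rem la [:: a; b] = eps_rem la [:: b; a].
Proof. by apply: eps_rem_perm; apply/permP => p /=; rewrite addnCA. Qed.

Lemma eps_rem_notin (la : {mset nat}) k s : k \notin la -> k \in s -> eps_rem la s = 0.
Proof.
move=> kla ks; rewrite (eps_rem_perm la (perm_to_rem ks)) eps_rem_behead.
by rewrite (negbTE kla).
Qed.

Lemma eps_part1 (la : {mset nat}) : 1%N \in la -> eps la = 0.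
Proof.
move=> la1; rewrite /eps (big_fsetD1 1%N) ?msuppE //= subrr expr0n mset_eq0 la1.
by rewrite !mul0r mulr0.
Qed.

(** A part 1 that survives the removal contributes the factor [1 - 1 = 0]. *)
Lemma eps_rem_part1 (la : {mset nat}) s :
  (count_mem 1%N s < la 1%N)%N -> eps_rem la s = 0.
Proof.
move=> lt1; rewrite /eps_rem; case: ifP => // _; apply: eps_part1.
by rewrite in_mset msetE2 mset_seqE subn_gt0.
Qed.

Lemma eps_rem_pair la a b : ~~ pair_in_supp la a b -> eps_rem la [:: a; b] = 0.
Proof.
rewrite /pair_in_supp !msuppE; have [->|_] := eqVneq a b; last first.
  rewrite negb_and => /orP[] h; rewrite (eps_rem_notin h) // !inE eqxx ?orbT //.
rewrite -ltnNge => h; rewrite /eps_rem; case: ifP => // /msubsetP/(_ b).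
by rewrite mset_seqE /= eqxx !addnS addn0 leqNgt h.
Qed.

(** The only removal that takes away two parts 1 is the one with [k = 1] in the second sum, where
    the coefficient [k(k-1)] vanishes; elsewhere a part 1 survives. *)
Lemma twin_coef_part11 (la : {mset nat}) : (1 < la 1%N)%N -> twin_coef la = 0.
Proof.
move=> la1; have lt1 k j : j != 1%N -> eps_rem la [:: k; j] = 0 /\ eps_rem la [:: k] = 0.
  by move=> /negbTE j1; split; apply: eps_rem_part1 => /=;
     rewrite ?j1; apply: leq_ltn_trans la1; case: (k == 1%N).
rewrite /twin_coef big1 => [|k _]; last by rewrite (lt1 k 2%N _).2 ?mulr0.
rewrite big1 => [|k _]; last first.
  have [->|k1] := eqVneq k 1%N; first by rewrite subrr mulr0 mul0r.
  by rewrite eps_remC (lt1 1%N k k1).1 mulr0.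
rewrite big1 => [|k _]; last by rewrite (lt1 k 2%N _).1 ?mulr0.
by rewrite (lt1 2%N 2%N _).2 ?addr0.
Qed.

Lemma sum_finsupp_pick (la : {mset nat}) k (f : nat -> rat) : k \in la ->
  (forall j, j != k -> f j = 0) -> \sum_(j <- finsupp la) f j = f k.
Proof.
move=> kla f0; rewrite (big_fsetD1 k) ?msuppE //= big1_fset ?addr0 // => j.
by rewrite !inE => /andP[/f0].
Qed.

(** Only removals that include the single part 1 survive, which leaves [-3 eps(mu)], the sum of the
    [k(k-1) eps(mu - k)], and [eps(mu - 2)]. *)
Lemma twin_coef_part1 (mu : {mset nat}) :
  is_partition mu -> mu 1%N = 0%N -> mu != mset0 ->
  twin_coef (mu `+` [mset 1%N]) = \sum_(i <- finsupp mu | (4 <= i)%N)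
                             (i%:R - 1) * (i%:R - 3) * eps_rem mu [:: i].
Proof.
move=> pmu mu1 mu0; set la := mu `+` _.
have la1 : la 1%N = 1%N by rewrite msetE2 mu1 msetnE eqxx.
have in1 : 1%N \in la by rewrite in_mset la1.
have laB : la `\ 1%N = mu by rewrite /la msetDC msetDKB.
have rem1 s : eps_rem la (1%N :: s) = eps_rem mu s by rewrite eps_rem_behead in1 laB.
have S1 : \sum_(k <- finsupp la) (2 * k%:R ^+ 2 - 5 * k%:R) * eps_rem la [:: k]
    = - 3%:R * eps_rem mu [::].
  rewrite (sum_finsupp_pick in1) ?rem1 => [|j /negbTE j1]; first by congr (_ * _); ring.
  by rewrite eps_rem_part1 ?mulr0 //= la1 j1.
have S2 : \sum_(k <- finsupp la) k%:R * (k%:R - 1) * eps_rem la [:: k; 1%N]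
    = \sum_(k <- finsupp mu) k%:R * (k%:R - 1) * eps_rem mu [:: k].
  under eq_bigr do rewrite eps_remC rem1.
  apply/esym/big_fset_incl => [|k _]; first by apply: finsuppS; rewrite -laB msubsetDl.
  by rewrite msuppE => h; rewrite (eps_rem_notin h) ?mem_head ?mulr0.
have S3 : \sum_(k <- finsupp la) (k != 0%N)%:R * eps_rem la [:: k; 2%N]
    = eps_rem mu [:: 2%N].
  rewrite (sum_finsupp_pick in1) ?rem1 ?mul1r // => j /negbTE j1.
  by rewrite eps_rem_part1 ?mulr0 //= la1 j1.
have S4 : eps_rem la [:: 2%N] = 0 by rewrite eps_rem_part1 //= la1.
have S5 : eps_rem mu [:: 2%N]
    = \sum_(k <- finsupp mu) (k == 2%N)%:R * eps_rem mu [:: k].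
  case: (boolP (2%N \in mu)) => mu2.
    rewrite (sum_finsupp_pick mu2) ?mul1r // => j /negbTE->.
    by rewrite mul0r.
  rewrite (eps_rem_notin mu2) ?mem_head // big_seq big1 // => k.
  by case: eqP => [->|_]; rewrite ?mul0r // msuppE (negbTE mu2).
(* Expanding [-3 eps(mu)] by the recursion gives [eps(mu - k)] the coefficient [(k-1)(k-3)]; this is
   0 at [k = 3], and at [k = 2] its value [-1] is cancelled by [S5]. *)
rewrite /twin_coef S1 S2 S3 S4 S5 addr0 eps_rem_rec ?seq_mset0 // big_distrr /=.
rewrite -!big_split [RHS]big_mkcond; apply: eq_big_seq => k; rewrite msuppE => kmu /=.
case: k kmu => [|[|[|[|k]]]] /= kmu.
- by rewrite /is_partition kmu in pmu.
- by rewrite in_mset mu1 in kmu.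
- by ring.
- by ring.
- by ring.
Qed.

Lemma twin_coef_no12 (la : {mset nat}) : 1%N \notin la -> 2%N \notin la ->
  twin_coef la = \sum_(a <- finsupp la)
                   (2 * a%:R ^+ 2 - 5 * a%:R) * eps_rem la [:: a].
Proof.
move=> la1 la2; rewrite /twin_coef (eps_rem_notin la2) ?mem_head // addr0.
rewrite [X in _ + X + _]big1 => [|k _]; last first.
  by rewrite (eps_rem_notin la1) ?mulr0 // !inE eqxx orbT.
rewrite [X in _ + X]big1 => [|k _]; last first.
  by rewrite (eps_rem_notin la2) ?mulr0 // !inE eqxx orbT.
by rewrite !addr0.
Qed.

Lemma sum_finsupp_ge2 (la : {mset nat}) (f : nat -> rat) :
  is_partition la -> 1%N \notin la -> 2%N \in la ->
  \sum_(k <- finsupp la) f k = f 2%N + \sum_(k <- finsupp la | (3 <= k)%N) f k.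
Proof.
move=> la0 la1 la2; rewrite [in RHS]big_mkcond.
rewrite !(big_fsetD1 2%N (_ : _ \in finsupp la)) ?msuppE //=.
rewrite add0r; congr (_ + _); apply: eq_big_seq => k; rewrite !inE msuppE.
case: k => [|[|[|k]]] //= kla.
  by rewrite /is_partition kla in la0.
by rewrite kla in la1.
Qed.

(* The e_2 in the numerator cancels against the e_2 in the denominator. *)
Lemma twin_coef_part2 (la : {mset nat}) :
  is_partition la -> 1%N \notin la -> 2%N \in la -> la != seq_mset [:: 2%N] ->
  twin_coef la = \sum_(k <- finsupp la | (3 <= k)%N)
    ((2 * k%:R ^+ 2 - 5 * k%:R) * eps_rem la [:: k]
      + (2 - k%:R) * eps_rem la [:: k; 2%N]).
Proof.
move=> pla la1 la2 lan2; rewrite /twin_coef [X in _ + X + _ + _]big1 => [|k _]; last first.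
  by rewrite (eps_rem_notin la1) ?mulr0 // !inE eqxx orbT.
(* The term [k = 2] of the first sum is [-2 S], so [S] has total coefficient [-1]. The recursion for
   [S] then cancels [eps(la - 2 - 2)] and leaves [1 - (k - 1) = 2 - k] for [k >= 3]. *)
have := eps_rem_rec lan2; rewrite !sum_finsupp_ge2 // => e2.
rewrite addr0 /= mul1r; set S := eps_rem la [:: 2%N]; rewrite -/S in e2.
have -> : \sum_(k <- finsupp la | (3 <= k)%N) ((2 * k%:R ^+ 2 - 5 * k%:R) *
    eps_rem la [:: k] + (2 - k%:R) * eps_rem la [:: k; 2%N])
  = \sum_(k <- finsupp la | (3 <= k)%N) (2 * k%:R ^+ 2 - 5 * k%:R) * eps_rem la [:: k]
  + \sum_(k <- finsupp la | (3 <= k)%N) (k != 0%N)%:R * eps_rem la [:: k; 2%N]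
  - \sum_(k <- finsupp la | (3 <= k)%N) (k%:R - 1) * eps_rem la [:: k; 2%N].
  rewrite -sumrN -!big_split /=; apply: eq_bigr => k k3.
  have -> : k != 0%N by lia.
  by rewrite /=; ring.
have -> : \sum_(k <- finsupp la | (3 <= k)%N) (k%:R - 1) * eps_rem la [:: k; 2%N]
   = S - eps_rem la [:: 2%N; 2%N] by rewrite e2; ring.
by ring.
Qed.

Lemma twin_coef_twos (la : {mset nat}) :
  is_partition la -> la 1%N = 0%N -> la 2%N = size la -> (4 <= weight la)%N -> twin_coef la = 0.
Proof.
move=> pla la1 la2 wla.
have all2 : all (pred1 2%N) la by rewrite all_count count_mem_mset la2.
have sla : (0 < size la)%N.
  rewrite lt0n size_mset_eq0; apply: contraTneq wla => ->.
  by rewrite /weight enum_mset0 big_nil.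
rewrite twin_coef_part2 //.
- rewrite big_seq_cond big1 // => k; rewrite msuppE => /andP[kla].
  by have /eqP-> := allP all2 k kla.
- by rewrite -mset_eq0 la1.
- by rewrite in_mset la2.
apply: contraTneq wla => ->.
by rewrite (weightE (perm_eq_seq_mset _)) big_seq1.
Qed.

(** In [twin_coef_part2], expand [eps(la - a)] by the recursion. Its term [b = 2] combines with
    [2 - a] to [2a^2 - 6a + 2], and the terms [b >= 3] form the double sum. *)
Lemma twin_coef_mixed (la : {mset nat}) : is_partition la -> la 1%N = 0%N ->
  (1 <= la 2 < size la)%N ->
  twin_coef la =
    \sum_(a <- finsupp la | (3 <= a)%N)
      (\sum_(b <- finsupp la | (3 <= b)%N && pair_in_supp la a b)
         eps_rem la [:: a; b] * (2 * a%:R ^+ 2 - 5 * a%:R) * (b%:R - 1))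
    + \sum_(x <- finsupp la | (3 <= x)%N)
         eps_rem la [:: x; 2%N] * (2 * x%:R ^+ 2 - 6 * x%:R + 2).
Proof.
move=> pla la1 /andP[la2 lt2].
have in2 : 2%N \in la by rewrite in_mset.
have nin1 : 1%N \notin la by rewrite -mset_eq0 la1.
have lan k : la != seq_mset [:: k].
  apply/eqP => e; move: la2 lt2; rewrite e (perm_size (perm_eq_seq_mset _)) mset_seqE /=.
  by case: (k == 2%N).
rewrite twin_coef_part2 // -big_split /=; apply: eq_bigr => a a3.
have -> : \sum_(b <- finsupp la | (3 <= b)%N && pair_in_supp la a b)
     eps_rem la [:: a; b] * (2 * a%:R ^+ 2 - 5 * a%:R) * (b%:R - 1)
  = (2 * a%:R ^+ 2 - 5 * a%:R) *
    \sum_(b <- finsupp la | (3 <= b)%N) (b%:R - 1) * eps_rem la [:: b; a].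
  rewrite big_distrr big_mkcondr; apply: eq_bigr => b _ /=.
  case: (boolP (pair_in_supp la a b)) => [_|/eps_rem_pair]; rewrite (eps_remC _ a b).
    by ring.
  by move=> ->; rewrite !mulr0.
rewrite (eps_rem_rec (lan a)) sum_finsupp_ge2 // (eps_remC _ 2%N a).
by ring.
Qed.

(** * Existence, uniqueness and the six cases *)

Lemma chromatic_sym_size (H : sgraph) (m : {mset nat}) :
  size m != #|H| -> chromatic_sym H m = 0.
Proof.
move=> sm; rewrite /chromatic_sym (_ : [set _ | _] = set0) ?cards0 //.
apply/setP => k; rewrite !inE; apply/negbTE; rewrite negb_and; apply/orP; right.
apply: contra sm => /eqP <-.
by rewrite (perm_size (perm_eq_seq_mset _)) size_map -cardE.
Qed.

Theorem corollary3p30 (v : forall n : nat, cycle_graph n) :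
  exists c : {mset nat} -> rat,
  let F := fun d : nat => fps_scale 2^-1 (twinned_cycle_series v d) in
  [/\ e_expansion F c,
      (forall c' : {mset nat} -> rat, e_expansion F c' ->
         forall la : {mset nat}, is_partition la -> c' la = c la)
    & forall (k : nat) (la : {mset nat}),
      (4 <= k)%N -> is_partition la -> weight la = k ->
      [/\ (* (a) *)
          c [mset k] = k%:R * (2 * k%:R - 5),
          (* (b) *)
          ((1 < la 1)%N -> c la = 0)
        & [/\ (* (c) *)
              (la 1%N = 1%N ->
                forall mu : {mset nat}, la = mu `+` [mset 1%N] ->
                [/\ mu 1%N = 0%N,
                    c la = \sum_(i <- finsupp mu | (4 <= i)%N)
                             (i%:R - 1) * (i%:R - 3) * eps_rem mu [:: i]
                  & (~ (exists2 i, i \in la & (4 <= i)%N) -> c la = 0)]),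
              (* (d) *)
              (la 1%N = 0%N -> la 2%N = 0%N ->
                c la = \sum_(a <- finsupp la)
                         (2 * a%:R ^+ 2 - 5 * a%:R) * eps_rem la [:: a]),
              (* (e) *)
              (la 1%N = 0%N -> la 2%N = size la -> c la = 0)
            & (* (f) *)
              (la 1%N = 0%N -> (1 <= la 2 < size la)%N ->
                c la =
                  \sum_(a <- finsupp la | (3 <= a)%N)
                    (\sum_(b <- finsupp la | (3 <= b)%N && pair_in_supp la a b)
                       eps_rem la [:: a; b] * (2 * a%:R ^+ 2 - 5 * a%:R)
                         * (b%:R - 1))
                  + \sum_(x <- finsupp la | (3 <= x)%N)
                       eps_rem la [:: x; 2%N]
                         * (2 * x%:R ^+ 2 - 6 * x%:R + 2))]]].
Proof.
(* The series starts at [z^4], while [twin_coef] need not vanish in lower degrees: it is [-1] at the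
   partition [(2)]. *)
pose c (la : {mset nat}) : rat := if (weight la < 4)%N then 0 else twin_coef la.
exists c; move=> F.
have expF : e_expansion F c.
  (* When the degree of [m] is not [n], both sides vanish by homogeneity. *)
  move=> n m; have [sm|sm] := eqVneq (size m) n; last first.
    rewrite big_seq big1 => [|la].
      case: n sm => [|[|[|[|n]]]] sm; rewrite /F /fps_scale /= ?mulr0 //.
      by rewrite chromatic_sym_size ?mulr0 // card_option card_ord.
    rewrite in_partitions => /andP[_ /eqP wla].
    rewrite [esym_part _ _](_ : _ = 0) ?mulr0 //.
    by apply: contra_neq_eq sm => /esym_part_homog->.
  transitivity (e_series c m); last by rewrite coef_e_series sm.
  case: (ltnP n 4) => n4.
    rewrite coef_e_series big_seq big1 => [|la].
      by case: n n4 {sm} => [|[|[|[|n]]]] //; rewrite /F /fps_scale /= mulr0.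
    by rewrite in_partitions sm => /andP[_ /eqP wla]; rewrite /c wla n4 mul0r.
  rewrite (@eq_in_e_series c twin_coef); last first.
    by move=> la _ wla; rewrite /c wla sm ltnNge n4.
  case: n n4 sm => [|[|[|[|n]]]] // _ sm; rewrite /F /fps_scale /=.
  (* The factor 2 cancels against one half, and the constant [-3] disappears because [m] is
     nonempty. *)
  rewrite twin_cycle_series // mulrA mulVf ?mul1r // twin_series_expansion.
  rewrite coef_fpsD coef_fpsN coef_fps_muln coef_fps1.
  rewrite (_ : (m == mset0) = false) ?mul0rn ?subr0 //.
  by rewrite -size_mset_eq0 sm.
split=> // [c' expc' la pla|k la k4 pla wla].
  (* The difference of two expansions of the same series expands 0, so linear independence
     applies. *)
  apply/eqP; rewrite -subr_eq0; apply/eqP.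
  apply: (@e_series_eq0 (fun la => c' la - c la)) => //.
  apply: funext => m; rewrite coef_e_series.
  under eq_bigr do rewrite mulrBl.
  by rewrite sumrB -expc' -expF subrr.
have cE (nu : {mset nat}) : weight nu = k -> c nu = twin_coef nu.
  by move=> wnu; rewrite /c wnu ltnNge k4.
split.
- rewrite cE ?weight1 // twin_coef_no12 ?in_mset1; try by lia.
  rewrite finsupp_msetn /= big_seq_fset1 eps_rem_behead in_mset1 eqxx.
  by rewrite eps_rem0 msetBxx eps0; ring.
- by move=> la1; rewrite cE // twin_coef_part11.
split.
- move=> la1 mu def_la.
  have mu1 : mu 1%N = 0%N by move: la1; rewrite def_la msetE2 msetnE eqxx; lia.
  have pmu : is_partition mu.
    by move: pla; rewrite /is_partition def_la in_msetD negb_or => /andP[].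
  have mu0 : mu != mset0.
    apply: contraTneq k4 => mu0; rewrite -wla def_la mu0 weightD weight1.
    by rewrite /weight enum_mset0 big_nil.
  rewrite cE // def_la twin_coef_part1 //; split=> // no4.
  rewrite big_seq_cond big1 // => i; rewrite msuppE => /andP[imu i4].
  by case: no4; exists i; rewrite // in_msetD imu.
- by move=> la1 la2; rewrite cE // twin_coef_no12 // -mset_eq0 ?la1 ?la2.
- by move=> la1 la2; rewrite cE // twin_coef_twos // wla.
by move=> la1 la2; rewrite cE // twin_coef_mixed.
Qed.
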